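(* The $q$-Weierstrass weight of $P_\infty^k$ on $C_k$, a curve of genus $g=S_0(A,B)\geq2$, is \begin{align*} w^{(q)}(P_\infty^k) = \begin{dcases*}\frac{S_0(A^2,B^2)}{12}-S_0(A,B) & for $q=1$, \\ \frac{S_0(A^2,B^2)}{12} & for $q\geq2$. \end{dcases*}\end{align*}
   Context: Work over $\mathbb{C}$. Let $k\in\mathbb{N}$ and let $A=(a_1,\dots,a_k)$, $B=(b_1,\dots,b_k)\in\mathbb{N}^k$ with $\gcd(a_i,b_j)=1$ for all $i,j$. Let $g_0=\prod_{j=1}^k a_j$ and $g_i=g_{i-1}b_i/a_i$ for $1\le i\le k$ (so $G(A,B)=(g_i)_{i=0}^k$ is a compound sequence). For tuples $C$, $C^2$ denotes component-wise squaring, and $S_0(A,B)$ denotes the number of non-negative integers that are not non-negative integer linear combinations of $g_0,\dots,g_k$ (equivalently $S_0(A,B)=\tfrac{1}{2}\big(a_kb_1\,\sigma(\pi_k(A),\pi_1(B))-\sigma(A,B)+1\big)$, where $\sigma$ is the sum of the elements of the compound sequence and $\pi_i$ deletes the $i$th component of a tuple); $S_0(A^2,B^2)$ is defined likewise for the pair $(A^2,B^2)$. For $1\le i\le k$ let $f_i(x)\in\mathbb{C}[x]$ be a separable polynomial of degree $b_i$, and let $A_k=\{(x_0,\dots,x_k)\in\mathbb{C}^{k+1}: x_i^{a_i}=f_i(x_{i-1}) \text{ for } 1\le i\le k\}$. Assume the affine curve $A_k$ is nonsingular, let $C_k$ be its nonsingular projective model, and assume the genus of $C_k$ (which equals $S_0(A,B)$)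 is at least 2. $C_k$ has a unique point at infinity $P_\infty^k$. For $q\in\mathbb{N}$, if $\psi_1,\dots,\psi_{d_q}$ is a basis of holomorphic $q$-differentials on $C_k$ with strictly increasing orders of vanishing at $P$, the $q$-Weierstrass weight is $w^{(q)}(P)=\sum_{i=1}^{d_q}\mathrm{ord}_P(\psi_i)-\sum_{j=0}^{d_q-1}j$. *)

(* Defs.v *)
From HB Require Import structures.
From mathcomp Require Import all_boot all_order all_algebra all_field.
From mathcomp Require Import finmap.
From mathcomp Require Import boolp classical_sets cardinality reals.
From mathcomp Require Import complex.
From mathcomp Require Import mpoly.

Set Implicit Arguments.
Unset Strict Implicit.
Unset Printing Implicit Defensive.

Import Order.TTheory GRing.Theory Num.Theory.
Local Open Scope ring_scope.

(* Components are numbered from 0: a_{i+1} is nth 0 A i.  The truncated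
   division is exact, a_{i+1} being a factor of g_i. *)
Fixpoint compound (A B : seq nat) (i : nat) : nat :=
  if i is j.+1 then (compound A B j * nth 0 B j %/ nth 0 A j)%N
  else (\prod_(a <- A) a)%N.

Definition representable (A B : seq nat) (n : nat) : Prop :=
  exists c : 'I_(size A).+1 -> nat,
    n = (\sum_(i < (size A).+1) c i * compound A B i)%N.

(* fset_set is empty on infinite sets; this set is finite whenever the g_i
   have gcd 1, in particular when all a_i, b_j are positive and
   gcd(a_i, b_j) = 1 for all i, j. *)
Definition S0 (A B : seq nat) : nat :=
  (#|` fset_set (fun n : nat => ~ representable A B n)|)%fset.

Definition sqr_seq (A : seq nat) : seq nat := [seq (a ^ 2)%N | a <- A].

(* x_{i+1}^{a_{i+1}} - f_{i+1}(x_i); lift ord0 i has value i+1. *)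
Definition tower_eq (F : fieldType) (k : nat) (A : k.-tuple nat)
    (f : 'I_k -> {poly F}) (i : 'I_k) : {mpoly F[k.+1]} :=
  'X_(lift ord0 i) ^+ tnth A i
  - (map_poly (@mpolyC k.+1 F) (f i)).['X_(widen_ord (leqnSn k) i)].

Definition zero_locus (F : fieldType) (n m : nat)
    (h : 'I_m -> {mpoly F[n]}) (v : 'I_n -> F) : Prop :=
  forall i, (h i).@[v] = 0.

(* Jacobian criterion for a curve in affine n-space cut out by n - 1
   equations. *)
Definition nonsingular_curve (F : fieldType) (m : nat)
    (h : 'I_m -> {mpoly F[m.+1]}) : Prop :=
  forall v, zero_locus h v ->
    \rank (\matrix_(i < m, j < m.+1) ((h i)^`M(j)).@[v]) = m.

(* K, with coordinate functions x, is the fraction field of the coordinate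
   ring F[X_1, .., X_n] / I(V). *)
Definition is_function_field (F K : fieldType) (iota : {rmorphism F -> K})
    (n : nat) (V : ('I_n -> F) -> Prop) (x : 'I_n -> K) : Prop :=
  (forall p : {mpoly F[n]},
     mmap iota x p = 0 <-> (forall v, V v -> p.@[v] = 0)) /\
  (forall z : K, exists p r : {mpoly F[n]},
     mmap iota x r != 0 /\ z = mmap iota x p / mmap iota x r).

(* For a one-dimensional function field K / F with F algebraically closed, the
   points of the nonsingular projective model are the discrete valuation rings
   of K / F, given here by their normalised valuations.  The value of ord at 0
   is irrelevant. *)
Record curve_point (F K : fieldType) (iota : {rmorphism F -> K}) := CurvePoint {
  ord :> K -> int;
  ord_const : forall c : F, c != 0 -> ord (iota c) = 0;
  ord_mul : forall y z : K, y != 0 -> z != 0 -> ord (y * z) = ord y + ord z;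
  ord_add : forall y z : K, y != 0 -> z != 0 -> y + z != 0 ->
    Num.min (ord y) (ord z) <= ord (y + z);
  ord_unif : exists t : K, t != 0 /\ ord t = 1 }.

Definition regular_at (F K : fieldType) (iota : {rmorphism F -> K})
    (P : curve_point iota) (z : K) : Prop :=
  z = 0 \/ 0 <= P z.

(* A point of the model lies on the affine curve iff all the coordinate
   functions are regular there. *)
Definition at_infinity (F K : fieldType) (iota : {rmorphism F -> K})
    (n : nat) (x : 'I_n -> K) (P : curve_point iota) : Prop :=
  exists i, ~ regular_at P (x i).

Definition is_derivation (F K : fieldType) (iota : {rmorphism F -> K})
    (D : K -> K) : Prop :=
  [/\ forall y z, D (y + z) = D y + D z,
      forall y z, D (y * z) = D y * z + y * D z
    & forall c : F, D (iota c) = 0].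

(* The order of dx at P is that of dx/dt for a local parameter t at P, where
   d/dt is the F-derivation of K taking t to 1. *)
Definition ord_d (F K : fieldType) (iota : {rmorphism F -> K}) (x : K)
    (P : curve_point iota) : int :=
  xget 0 (fun n : int => exists (t : K) (D : K -> K),
    [/\ t != 0, P t = 1, is_derivation iota D, D t = 1 & P (D x) = n]).

(* In characteristic 0, for x in K nonconstant, each meromorphic q-differential
   is h (dx)^q for a unique h in K; it is represented by h below. *)
Definition qdiff_ord (F K : fieldType) (iota : {rmorphism F -> K}) (x : K)
    (q : nat) (P : curve_point iota) (h : K) : int :=
  P h + q%:Z * ord_d x P.

Definition holomorphic (F K : fieldType) (iota : {rmorphism F -> K}) (x : K)
    (q : nat) (h : K) : Prop :=
  forall P : curve_point iota, h = 0 \/ 0 <= qdiff_ord x q P h.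

Definition is_holo_basis (F K : fieldType) (iota : {rmorphism F -> K}) (x : K)
    (q d : nat) (psi : 'I_d -> K) : Prop :=
  (forall i, holomorphic iota x q (psi i)) /\
  (forall h, holomorphic iota x q h ->
     exists! c : 'rV[F]_d, h = \sum_(i < d) iota (c 0 i) * psi i).

Definition is_genus (F K : fieldType) (iota : {rmorphism F -> K}) (x : K)
    (g : nat) : Prop :=
  exists psi : 'I_g -> K, is_holo_basis iota x 1 psi.

Definition adapted_basis (F K : fieldType) (iota : {rmorphism F -> K}) (x : K)
    (q : nat) (P : curve_point iota) (d : nat) (psi : 'I_d -> K) : Prop :=
  is_holo_basis iota x q psi /\
  (forall i j : 'I_d, (i < j)%N ->
     qdiff_ord x q P (psi i) < qdiff_ord x q P (psi j)).

(* The weight is computed from an adapted basis: one exists, and all of them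
   give the value w. *)
Definition is_weierstrass_weight (F K : fieldType) (iota : {rmorphism F -> K})
    (x : K) (q : nat) (P : curve_point iota) (w : rat) : Prop :=
  (exists (d : nat) (psi : 'I_d -> K), adapted_basis x q P psi) /\
  (forall (d : nat) (psi : 'I_d -> K), adapted_basis x q P psi ->
     (\sum_(i < d) qdiff_ord x q P (psi i) - \sum_(j < d) (j : nat)%:Z)%:~R = w).

(* Main.v *)
Require Import Defs.
From HB Require Import structures.
From mathcomp Require Import all_boot all_order all_algebra all_field.
From mathcomp Require Import finmap.
From mathcomp Require Import boolp classical_sets cardinality reals.
From mathcomp Require Import complex.
From mathcomp Require Import mpoly.
From mathcomp Require Import ring zify.

(* Write g_i for the compound sequence and S for the semigroup it generates.  At a
point P at infinity x_i has a pole of order g_i, and modulo the tower equations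
each polynomial in the x_i reduces to a combination of normal monomials (exponent
of x_i less than a_i for i >= 1), whose pole orders are pairwise distinct and run
through S.  Hence the coordinate ring O has a basis indexed by S, and P is unique.
The vector field x_i |-> tangent i, whose components are the maximal minors of the
Jacobian, does not vanish on the smooth affine curve; so holomorphic q-differentials
are the y (dx_0 / tangent 0)^q with y regular on the affine curve, that is y in O,
and with pole order at most q (2 G - 2) at infinity, G being the number of gaps of
S.  Their orders at P are thus q (2 G - 2) - s for s in S, and the weight is
(sum of the gaps) - G (G - 1) / 2, less G when q = 1.  Selmer's argument on the
Apery set of S, a sum over a box, evaluates the sum of the gaps and identifies
the result with the number of gaps for the squared data. *)

Set Implicit Arguments.
Unset Strict Implicit.
Unset Printing Implicit Defensive.

Import Order.TTheory GRing.Theory Num.Theory.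
Local Open Scope ring_scope.

(** Points of the model are given only as normalised valuations of K, so every order has to be
    derived from the equations. At infinity these fix the orders of the x_i only up to a common
    factor, which normalisation then forces to be 1. The order of dx_0 there is found without an
    explicit local parameter: D z / z, measured against D x_0 / x_0, is congruent to ord z / ord x_0
    modulo the maximal ideal, and this gives the order of D s for every s of order 1. On the affine
    part the Jacobian is bidiagonal; full rank at v singles out an index j for which x_j - v_j is a
    local parameter, and the valuation it defines turns each solution v into a point of the model.
    This is what makes a function regular at all affine points an element of O: otherwise its
    denominators would form a proper ideal, which has a zero v. The 12 of the statement comes from
    the variance (n^2 - 1) / 12 of n consecutive integers: twelve times the variance of the Apery
    set obeys the recursion that the largest Apery element obeys for the squared data. *)

(** * The numerical semigroup of a compound sequence *)

Section CompoundSemigroup.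
Local Open Scope nat_scope.
Variables a b : nat -> nat.

(* Closed form g_i = b_1 ... b_i a_{i+1} ... a_k of the compound sequence, with
   components numbered from 0. *)
Definition cpd (k i : nat) := (\prod_(j < i) b j * \prod_(i <= j < k) a j)%N.

Definition lincomb (k : nat) (e : nat -> nat) := (\sum_(i < k.+1) e i * cpd k i)%N.

Definition admissible k := [/\ forall i, i < k -> 0 < a i, forall i, i < k -> 0 < b i
  & forall i j, i < k -> j < k -> coprime (a i) (b j)].

Lemma admissibleW k : admissible k.+1 -> admissible k.
Proof.
by case=> ha hb hc; split=> [i ik|i ik|i j ik jk];
  [apply: ha|apply: hb|apply: hc]; apply: ltnW.
Qed.

Lemma cpdS k i : i <= k -> cpd k.+1 i = a k * cpd k i.
Proof. by move=> ik; rewrite /cpd big_nat_recr //= mulnA mulnC. Qed.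

Lemma cpdkk k : cpd k k = \prod_(j < k) b j.
Proof. by rewrite /cpd big_geq // muln1. Qed.

Lemma cpd0 k : cpd k 0 = \prod_(0 <= j < k) a j.
Proof. by rewrite /cpd big_ord0 mul1n. Qed.

Lemma cpd_step k i : i < k -> cpd k i.+1 * a i = cpd k i * b i.
Proof.
by move=> ik; rewrite /cpd big_ord_recr /= [in RHS]big_ltn // ; ring.
Qed.

Lemma cpd_gt0 k i : admissible k -> i <= k -> 0 < cpd k i.
Proof.
move=> [ha hb _] ik; rewrite /cpd muln_gt0; apply/andP; split.
  by apply: prodn_cond_gt0 => j _; apply: hb; apply: leq_trans (ltn_ord j) ik.
by rewrite big_seq; apply: prodn_cond_gt0 => j;
  rewrite mem_index_iota => /andP[_]; apply: ha.
Qed.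

Lemma lincombS k e :
  lincomb k.+1 e = a k * lincomb k e + e k.+1 * \prod_(j < k.+1) b j.
Proof.
rewrite /lincomb big_ord_recr /= cpdkk big_distrr /=.
apply: (congr1 (addn^~ _)); apply: eq_bigr => i _.
by rewrite cpdS 1?mulnCA // -ltnS.
Qed.

Lemma coprime_prod (I : finType) m (h : I -> nat) :
  (forall i, coprime m (h i)) -> coprime m (\prod_i h i).
Proof.
move=> hm; elim/big_rec: _ => [|i n _ IH]; first by rewrite coprimen1.
by rewrite coprimeMr hm IH.
Qed.

Lemma coprime_last k : admissible k.+1 -> coprime (a k) (\prod_(j < k.+1) b j).
Proof. by case=> _ _ hc; apply: coprime_prod => i; apply: hc. Qed.

Lemma coprime_cpd k : admissible k -> coprime (cpd k 0) (cpd k k).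
Proof.
move=> [_ _ hc]; rewrite cpd0 cpdkk big_mkord.
apply: coprime_prod => j; rewrite coprime_sym.
by apply: coprime_prod => i; rewrite coprime_sym; apply: hc.
Qed.

(** Modulo [a k] the product of the [b j] is a unit, so the digit [c] is determined there, and both
    digits are below [a k]. *)
Lemma glue_inj k m m' c c' : admissible k.+1 -> c < a k -> c' < a k ->
  a k * m + c * \prod_(j < k.+1) b j = a k * m' + c' * \prod_(j < k.+1) b j ->
  m = m' /\ c = c'.
Proof.
move=> gk ca ca' eqn; have ecc : c = c'.
  have : c * \prod_(j < k.+1) b j = c' * \prod_(j < k.+1) b j %[mod a k].
    by have := congr1 (modn^~ (a k)) eqn; rewrite !(mulnC (a k)) !modnMDl.
  wlog lecc : c c' ca ca' {eqn} / c <= c' => [hw|].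
    by case/orP: (leq_total c c') => ? e; [apply: hw|apply/esym/hw].
  move/esym/eqP; rewrite eqn_mod_dvd ?leq_mul2r ?lecc ?orbT // -mulnBl.
  rewrite Gauss_dvdl ?coprime_last // => /dvdn_leq h; apply/eqP.
  by rewrite eqn_leq lecc /=; move: h; lia.
split=> //; move: eqn; rewrite ecc => /addIn/eqP.
have [ha _ _] := gk; have := ha k (ltnSn k) => a0.
by rewrite eqn_pmul2l // => /eqP.
Qed.

Definition normal k (e : nat -> nat) := forall i, i < k -> e i.+1 < a i.

Lemma lincomb_inj k e e' : admissible k -> normal k e -> normal k e' ->
  lincomb k e = lincomb k e' -> forall i, i <= k -> e i = e' i.
Proof.
elim: k => [|k IH] gk ne ne'.
  rewrite /lincomb !big_ord1 /cpd big_ord0 big_geq // !muln1 => ? i.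
  by rewrite leqn0 => /eqP->.
rewrite !lincombS => /glue_inj [] //; rewrite ?ne ?ne' // => e1 e2 i.
rewrite leq_eqVlt => /orP[/eqP->//|]; rewrite ltnS.
apply: IH => //; first exact: admissibleW.
  by move=> j jk; apply: ne; apply: ltnW.
by move=> j jk; apply: ne'; apply: ltnW.
Qed.

(* Apery set of the semigroup with respect to g_0; it contains one element of each
   residue class modulo g_0. *)
Fixpoint apery k : seq nat := if k is k'.+1 then
  [seq a k' * w + c * \prod_(j < k'.+1) b j | w <- apery k', c <- iota 0 (a k')]
  else [:: 0].

(** Membership is made decidable through the Apery set, so that the gaps can be filtered from a
    finite list; [in_sg_lincombP] identifies it with being a combination of the generators. *)
Definition in_sg k n : bool :=
  has (fun w => (w <= n) && (w == n %[mod cpd k 0])) (apery k).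

(* Largest element of the Apery set, so wmax - g_0 is the Frobenius number. *)
Fixpoint wmax k := if k is k'.+1 then
  a k' * wmax k' + (a k' - 1) * \prod_(j < k'.+1) b j else 0.

Lemma wmaxE k : wmax k = \sum_(l < k) (a l - 1) * cpd k l.+1.
Proof.
elim: k => [|k IH] /=; first by rewrite big_ord0.
rewrite [RHS]big_ord_recr /= cpdkk IH big_distrr /=; congr (_ + _).
by apply: eq_bigr => i _; rewrite cpdS // mulnCA.
Qed.

Lemma size_apery k : size (apery k) = cpd k 0.
Proof.
elim: k => [|k IH]; first by rewrite cpd0 big_geq.
by rewrite /= size_allpairs IH size_iota cpdS // mulnC.
Qed.

Lemma apery_le k w : w \in apery k -> w <= wmax k.
Proof.
elim: k w => [|k IH] w /=; first by rewrite inE => /eqP->.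
case/allpairsP=> -[u c] /= [/IH uk]; rewrite mem_iota /= => ca ->.
by apply: leq_add; rewrite ?leq_mul2l ?uk ?orbT // leq_mul2r; apply/orP; right; lia.
Qed.

Lemma wmax_apery k : admissible k -> wmax k \in apery k.
Proof.
elim: k => [|k IH] gk /=; first by rewrite inE.
have [ha _ _] := gk; have a0 := ha k (ltnSn k).
apply/allpairsP; exists (wmax k, a k - 1) => /=; split=> //; first exact/IH/admissibleW.
by rewrite mem_iota /=; lia.
Qed.

Lemma apery_inj k w w' c c' : admissible k -> w \in apery k -> w' \in apery k ->
  w + c * cpd k 0 = w' + c' * cpd k 0 -> w = w' /\ c = c'.
Proof.
elim: k w w' c c' => [|k IH] w w' c c' gk.
  rewrite cpd0 big_geq // !inE !muln1 => /eqP-> /eqP->; lia.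
move=> /allpairsP[[u d]] /= [uA]; rewrite mem_iota /= => da ->.
move=> /allpairsP[[u' d']] /= [uA']; rewrite mem_iota /= => da' ->.
rewrite cpdS // => eqn.
have [] := @glue_inj k (u + c * cpd k 0) (u' + c' * cpd k 0) d d' gk da da'.
  by move: eqn; rewrite (mulnCA c) (mulnCA c') addnAC -mulnDr => ->; rewrite addnAC -mulnDr.
by case/(IH _ _ _ _ (admissibleW gk) uA uA') => -> -> ->.
Qed.

Lemma apery_mod_inj k w w' : admissible k -> w \in apery k -> w' \in apery k ->
  w = w' %[mod cpd k 0] -> w = w'.
Proof.
move=> gk wA wA' e.
have := @apery_inj k w w' (w' %/ cpd k 0) (w %/ cpd k 0) gk wA wA'.
case=> //; rewrite [in LHS](divn_eq w (cpd k 0)) [in RHS](divn_eq w' (cpd k 0)) e.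
by rewrite addnAC [RHS]addnAC [(_ + w %/ _ * _)%N]addnC.
Qed.

Lemma apery_uniq k : admissible k -> uniq (apery k).
Proof.
elim: k => [|k IH] gk //=; apply: allpairs_uniq; rewrite ?iota_uniq //.
  exact/IH/admissibleW.
move=> [u c] [u' c'] /allpairsP[[u1 c1]] /= [_ h1 [-> ->]].
move=> /allpairsP[[u2 c2]] /= [_ h2 [-> ->]].
by move: h1 h2; rewrite !mem_iota /= => h1 h2 /glue_inj[] // -> ->.
Qed.

(** Pigeonhole: there are [cpd k 0] Apery elements, pairwise incongruent modulo [cpd k 0]. *)
Lemma apery_residue k n : admissible k -> exists2 w, w \in apery k & w = n %[mod cpd k 0].
Proof.
move=> gk; have c0 : 0 < cpd k 0 by apply: cpd_gt0.
have u : uniq [seq w %% cpd k 0 | w <- apery k].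
  rewrite map_inj_in_uniq ?apery_uniq // => w w' wA wA' e.
  exact: (apery_mod_inj gk).
have /(uniq_min_size u) : {subset [seq w %% cpd k 0 | w <- apery k] <= iota 0 (cpd k 0)}.
  by move=> _ /mapP[w _ ->]; rewrite mem_iota /= add0n ltn_pmod.
rewrite size_map size_apery size_iota => -[] // _ E.
have : n %% cpd k 0 \in [seq w %% cpd k 0 | w <- apery k].
  by rewrite E mem_iota /= add0n ltn_pmod.
by case/mapP => w wA e; exists w.
Qed.

Lemma in_sg_aperyP k n : admissible k ->
  in_sg k n <-> exists w c, w \in apery k /\ n = w + c * cpd k 0.
Proof.
move=> gk; split=> [/hasP[w wA /andP[wn e]]|[w [c [wA ->]]]].
  exists w, ((n - w) %/ cpd k 0); split=> //.
  by rewrite divnK ?subnKC // -eqn_mod_dvd // eq_sym.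
by apply/hasP; exists w => //; rewrite leq_addr /= addnC modnMDl.
Qed.

Lemma in_sg_normal k n : admissible k -> in_sg k n ->
  exists2 e, normal k e & n = lincomb k e.
Proof.
move=> gk /(in_sg_aperyP _ gk); elim: k n gk => [|k IH] n gk.
  case=> w [c]; rewrite inE cpd0 big_geq // => -[/eqP-> ->].
  by exists (fun=> c) => //; rewrite /lincomb big_ord1 cpd0 big_geq.
case=> w [c] [/allpairsP[[u d]] /= [uA]]; rewrite mem_iota => /andP[_ da] -> ->.
have [|e ne ue] := IH (u + c * cpd k 0) (admissibleW gk); first by exists u, c.
exists (fun i => if i == k.+1 then d else e i).
  move=> i; rewrite ltnS leq_eqVlt => /orP[/eqP->|ik]; first by rewrite eqxx.
  by rewrite eqSS ltn_eqF // ne.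
rewrite lincombS eqxx; suff -> : lincomb k (fun i => if i == k.+1 then d else e i)
   = u + c * cpd k 0 by rewrite cpdS // mulnDr (mulnCA (a k)) addnAC.
by rewrite ue; apply: eq_bigr => i _; rewrite ltn_eqF.
Qed.

Lemma in_sg_lincombP k n : admissible k ->
  reflect (exists e, n = lincomb k e) (in_sg k n).
Proof.
move=> gk; apply: (iffP idP) => [/(in_sg_normal gk)[e _ ->]|H]; first by exists e.
apply/(in_sg_aperyP _ gk); elim: k n gk H => [|k IH] n gk [e ->].
  exists 0, (e 0); rewrite inE; split=> //.
  by rewrite /lincomb big_ord1.
rewrite lincombS; have [ha hb _] := gk; have a0 := ha k (ltnSn k).
(* A carry: writing e_{k+1} = q a_k + r, the part q a_k of the last coefficient is traded for q b_k
   more copies of the generator of index k, and r stays as the digit. *)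
set m := lincomb k (fun i => if i == k then e k + (e k.+1 %/ a k) * b k else e i).
have em : m = lincomb k e + (e k.+1 %/ a k) * \prod_(j < k.+1) b j.
  rewrite /m /lincomb !big_ord_recr /= eqxx cpdkk mulnDl addnA; congr (_ + _ + _).
    by apply: eq_bigr => i _; rewrite ltn_eqF.
  by rewrite -!mulnA (mulnC (b k)).
have [|w [c [wA ec]]] := IH m (admissibleW gk); first by eexists.
exists (a k * w + e k.+1 %% a k * \prod_(j < k.+1) b j), c; split.
  by apply/allpairsP; exists (w, e k.+1 %% a k); rewrite mem_iota /= add0n ltn_pmod.
rewrite cpdS // (mulnCA c) addnAC -mulnDr -ec em.
by rewrite {1}(divn_eq (e k.+1) (a k)) mulnDl mulnDr addnA (mulnC _ (a k)) mulnA.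
Qed.

Lemma in_sg_ge k n : admissible k -> wmax k <= n -> in_sg k n.
Proof.
move=> gk le; have [w wA e] := apery_residue n gk.
by apply/hasP; exists w => //; rewrite (leq_trans (apery_le wA)) //= e.
Qed.

(** Agreement of the recursive list with the intrinsic notion: least element of the semigroup in its
    residue class. This is what makes the sums over gaps telescope. *)
Lemma aperyE k n : admissible k ->
  (n \in apery k) = in_sg k n && ((n < cpd k 0) || ~~ in_sg k (n - cpd k 0)).
Proof.
move=> gk; have c0 : 0 < cpd k 0 by apply: cpd_gt0.
apply/idP/andP => [nA|[/hasP[w wA /andP[wn /eqP e]]]].
  split; first by apply/hasP; exists n; rewrite ?leqnn ?eqxx.
  rewrite ltnNge -implybE; apply/implyP => le.
  apply/negP => /hasP[w wA /andP[wn /eqP e]].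
  have : w = n by apply: (apery_mod_inj gk) => //; rewrite e -{2}(subnK le) modnDr.
  lia.
case/orP => [ns|].
  have q0 : (n - w) %/ cpd k 0 = 0 by rewrite divn_small //; lia.
  suff <- : w = n by [].
  have : cpd k 0 %| n - w by rewrite -eqn_mod_dvd // e.
  by move/divnK; rewrite q0; lia.
move=> nsg; suff <- : w = n by [].
apply/eqP; rewrite eqn_leq wn /= leqNgt; apply/negP => lt.
case/negP: nsg; apply/hasP; exists w => //.
have /dvdnP[[|q] eq] : cpd k 0 %| n - w by rewrite -eqn_mod_dvd // e.
  lia.
have -> : n = (w + q * cpd k 0) + cpd k 0 by lia.
by rewrite addnK leq_addr /= addnC modnMDl.
Qed.

Definition gaps k := [seq n <- iota 0 (wmax k) | ~~ in_sg k n].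

Lemma mem_gaps k n : admissible k -> (n \in gaps k) = ~~ in_sg k n.
Proof.
move=> gk; rewrite mem_filter mem_iota /= add0n.
case: (boolP (in_sg k n)) => //= h; apply: contraNT h; rewrite -leqNgt.
exact: in_sg_ge.
Qed.

(** A gap lies strictly below the Apery element of its class, hence at least [cpd k 0] below it. The
    bound on the gaps by the Frobenius number is phrased without truncated subtraction. *)
Lemma gaps_le k n : admissible k -> ~~ in_sg k n -> n + cpd k 0 <= wmax k.
Proof.
move=> gk nsg; have [w wA e] := apery_residue n gk.
have lt : n < w.
  rewrite ltnNge; apply: contra nsg => le.
  by apply/hasP; exists w => //; rewrite le e /=.
apply: leq_trans (apery_le wA); have : cpd k 0 %| w - n.
  by rewrite -eqn_mod_dvd ?e // ltnW.
by move/dvdn_leq; rewrite subn_gt0 => /(_ lt); lia.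
Qed.

Lemma frobenius_gap k : admissible k -> cpd k 0 <= wmax k -> ~~ in_sg k (wmax k - cpd k 0).
Proof.
move=> gk le; have := wmax_apery gk; rewrite aperyE // => /andP[_].
by rewrite ltnNge le.
Qed.

(** * Number and sum of the gaps *)

Local Open Scope ring_scope.

(* In a residue class modulo g_0 the gaps run from the least residue to just below
   the Apery element, hence the telescoping. *)
Lemma sum_gaps_telescope k (phi : nat -> rat) : admissible k ->
  \sum_(n <- gaps k) (phi (n + cpd k 0)%N - phi n) =
  \sum_(w <- apery k) phi w - \sum_(0 <= r < cpd k 0) phi r.
Proof.
move=> gk; set g := cpd k 0; set M := wmax k.
pose chi n : rat := (~~ in_sg k n)%:R.
have -> : \sum_(n <- gaps k) (phi (n + g)%N - phi n) =
   \sum_(0 <= n < M) chi n * phi (n + g)%N - \sum_(0 <= n < M) chi n * phi n.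
  rewrite /gaps big_filter -sumrB /index_iota subn0 big_mkcond /=.
  by apply: eq_bigr => n _; rewrite /chi; case: in_sg => /=; rewrite ?mul0r ?subrr ?mul1r.
have -> : \sum_(0 <= n < M) chi n * phi n = \sum_(0 <= n < M + g) chi n * phi n.
  rewrite (@big_cat_nat _ _ _ M 0 (M + g)) //= ?leq_addr //.
  rewrite [X in _ = _ + X]big_nat_cond [X in _ = _ + X]big1 ?addr0 // => n.
  by rewrite andbT => /andP[le _]; rewrite /chi in_sg_ge ?mul0r.
have -> : \sum_(w <- apery k) phi w =
   \sum_(0 <= n < M + g) (n \in apery k)%:R * phi n.
  have := @uniq_perm _ (apery k) [seq n <- index_iota 0 (M + g) | n \in apery k].
  rewrite apery_uniq // filter_uniq ?iota_uniq // => /(_ isT isT) H.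
  rewrite (perm_big _ (H _)) /= ?big_filter ?big_mkcond /=.
    by apply: eq_bigr => n _; case: ifP; rewrite ?mul1r ?mul0r.
  move=> w; rewrite mem_filter mem_index_iota /=; case: (boolP (w \in _)) => // wA.
  have := apery_le wA; have : (0 < g)%N by apply: cpd_gt0.
  by rewrite -/M; lia.
have -> : \sum_(0 <= n < M) chi n * phi (n + g)%N =
    \sum_(g <= n < M + g) chi (n - g)%N * phi n.
  rewrite -{2}[g]add0n big_addn addnK.
  by apply: eq_bigr => n _; rewrite addnK.
rewrite !(@big_cat_nat _ _ _ g 0 (M + g)) //= ?leq_addl //.
have e1 : - \sum_(0 <= n < g) chi n * phi n =
  \sum_(0 <= n < g) (n \in apery k)%:R * phi n - \sum_(0 <= n < g) phi n.
  rewrite -sumrN -sumrB; apply: eq_big_nat => n /andP[_ ng].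
  by rewrite aperyE // ng /= andbT /chi; case: in_sg => /=; ring.
have e2 : \sum_(g <= n < M + g) chi (n - g)%N * phi n -
    \sum_(g <= n < M + g) chi n * phi n =
  \sum_(g <= n < M + g) (n \in apery k)%:R * phi n.
  rewrite -sumrB; apply: eq_big_nat => n /andP[gn _].
  rewrite aperyE // ltnNge gn /= /chi -/g.
  case: (boolP (in_sg k n)) => /= h1; case: (boolP (in_sg k _)) => /= h2; try ring.
  (* The impossible case, n a gap with n - g in the semigroup: one more copy of g_0 represents n. *)
  case/negP: h1; apply/in_sg_lincombP => //.
  case/in_sg_lincombP: h2 => // e h2.
  exists (fun i => if i == 0%N then (e 0).+1 else e i).
  rewrite -(subnK gn) h2 /lincomb !big_ord_recl /= -/g mulSn -[in LHS]/g.
  by rewrite addnC addnA.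
by rewrite -e2 opprD e1; ring.
Qed.

Lemma sum_iota1 n : \sum_(0 <= i < n) (i%:R : rat) = n%:R * (n%:R - 1) / 2.
Proof.
elim: n => [|n IH]; first by rewrite big_geq // mul0r mul0r.
by rewrite big_nat_recr //= IH -natr1; field.
Qed.

Lemma sum_iota2 n : \sum_(0 <= i < n) (i%:R ^+ 2 : rat) =
  n%:R * (n%:R - 1) * (2 * n%:R - 1) / 6.
Proof.
elim: n => [|n IH]; first by rewrite big_geq // !mul0r.
by rewrite big_nat_recr //= IH -natr1; field.
Qed.

(* Twelve times the variance of the Apery set.  It is also the value of wmax for
   the squared data, see wmax_sqr. *)
Fixpoint wvar k : rat := if k is k'.+1 then
  (a k')%:R ^+ 2 * wvar k' + ((a k')%:R ^+ 2 - 1) * (\prod_(j < k'.+1) b j)%:R ^+ 2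
  else 0.

Lemma wmaxS k : admissible k.+1 -> (wmax k.+1)%:R =
  (a k)%:R * (wmax k)%:R + ((a k)%:R - 1) * (\prod_(j < k.+1) b j)%:R :> rat.
Proof.
move=> [ha _ _]; rewrite [wmax _]/= natrD !natrM natrB //; exact: ha.
Qed.

(** The box is symmetric about its centre, so the mean is half the maximum. *)
Lemma sum_apery1 k : admissible k ->
  \sum_(w <- apery k) (w%:R : rat) = (cpd k 0)%:R * (wmax k)%:R / 2.
Proof.
elim: k => [|k IH] gk.
  by rewrite /= big_seq1 mulr0 mul0r.
rewrite wmaxS // [apery _]/= big_allpairs_dep /=.
set B := \prod_(_ < _) _.
under eq_bigr => w _ do rewrite -(subn0 (a k)) -/(index_iota 0 (a k)).
have E w : \sum_(0 <= i < a k) ((a k * w + i * B)%:R : rat) =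
   (a k)%:R ^+ 2 * w%:R + (a k)%:R * ((a k)%:R - 1) / 2 * B%:R.
  under eq_bigr => i _ do rewrite natrD (natrM _ i).
  rewrite big_split /= -mulr_suml sum_iota1 sumr_const_nat subn0 -mulr_natl natrM.
  ring.
under eq_bigr => w _ do rewrite subn0 E.
rewrite big_split /= -mulr_sumr IH; last exact: admissibleW.
rewrite big_const_seq count_predT iter_addr_0 size_apery cpdS // natrM -mulr_natl.
by field.
Qed.

(** Second moment as variance plus squared mean. A new digit, uniform on 0, ..., a - 1 and scaled by
    the product B of the [b j], is independent of the others and adds (a^2 - 1) B^2 / 12 to the
    variance. *)
Lemma sum_apery2 k : admissible k ->
  \sum_(w <- apery k) (w%:R ^+ 2 : rat) =
  (cpd k 0)%:R * (wvar k / 12 + (wmax k)%:R ^+ 2 / 4).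
Proof.
elim: k => [|k IH] gk.
  by rewrite /= big_seq1; field.
rewrite wmaxS // [apery _]/= big_allpairs_dep /= -/(wvar k).
set B := \prod_(_ < _) _.
have E w : \sum_(0 <= i < a k) ((a k * w + i * B)%:R ^+ 2 : rat) =
   (a k)%:R ^+ 3 * w%:R ^+ 2
   + (a k)%:R ^+ 2 * ((a k)%:R - 1) * B%:R * w%:R
   + (a k)%:R * ((a k)%:R - 1) * (2 * (a k)%:R - 1) / 6 * B%:R ^+ 2.
  have E1 i : ((a k * w + i * B)%:R ^+ 2 : rat) =
     (a k)%:R ^+ 2 * w%:R ^+ 2 + 2 * (a k)%:R * w%:R * B%:R * i%:R
      + B%:R ^+ 2 * i%:R ^+ 2 by rewrite natrD !natrM; ring.
  under eq_bigr => i _ do rewrite E1.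
  rewrite !big_split /= -!mulr_sumr sum_iota1 sum_iota2 sumr_const_nat subn0 -mulr_natl.
  by field.
under eq_bigr => w _ do rewrite -(subn0 (a k)) -/(index_iota 0 (a k)) subn0 E.
rewrite !big_split /= -!mulr_sumr IH ?sum_apery1; try exact: admissibleW.
rewrite big_const_seq count_predT iter_addr_0 size_apery cpdS // natrM -mulr_natl.
by field.
Qed.

(** Telescoping with phi n = n, where each gap contributes exactly [cpd k 0]. *)
Lemma size_gaps k : admissible k ->
  (size (gaps k))%:R = ((wmax k)%:R - (cpd k 0)%:R + 1) / 2 :> rat.
Proof.
move=> gk; have := sum_gaps_telescope (fun n => n%:R) gk.
rewrite sum_apery1 // sum_iota1.
under eq_bigr => n _ do rewrite natrD addrAC subrr add0r.
rewrite big_const_seq count_predT iter_addr_0 -[_ *+ size _]mulr_natr => E.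
have c0 : (cpd k 0)%:R != 0 :> rat by rewrite pnatr_eq0 -lt0n cpd_gt0.
by apply: (mulfI c0); rewrite E; field.
Qed.

(** Telescoping with phi n = n^2, where a gap n contributes 2 g_0 n + g_0^2. The right-hand side is
    arranged so that its last term has the shape of [size_gaps] for the squared data, with [wvar k]
    in the role of the largest Apery element. *)
Lemma sum_gaps k : admissible k ->
  12 * \sum_(n <- gaps k) (n%:R : rat) =
  6 * (size (gaps k))%:R * ((size (gaps k))%:R - 1)
  + (wvar k - (cpd k 0)%:R ^+ 2 + 1) / 2.
Proof.
move=> gk; have := sum_gaps_telescope (fun n => n%:R ^+ 2) gk.
rewrite sum_apery2 // sum_iota2.
have E n : (n + cpd k 0)%:R ^+ 2 - n%:R ^+ 2 =
   2 * (cpd k 0)%:R * n%:R + (cpd k 0)%:R ^+ 2 :> rat by rewrite natrD; ring.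
under eq_bigr => n _ do rewrite E.
rewrite big_split /= -mulr_sumr big_const_seq count_predT iter_addr_0 -[_ *+ size _]mulr_natr.
rewrite size_gaps //; move: (\sum_(_ <- _) _) => s; set G := (_ + 1) / 2 => Es.
have c0 : (cpd k 0)%:R != 0 :> rat by rewrite pnatr_eq0 -lt0n cpd_gt0.
apply: (mulIf c0); apply: (@mulfI _ (2^-1)) => //.
have -> : 2^-1 * (12 * s * (cpd k 0)%:R) = 3 * (2 * (cpd k 0)%:R * s) by field.
by rewrite -[2 * _ * s](addrK ((cpd k 0)%:R ^+ 2 * G)) Es /G; field.
Qed.

Lemma twice_size_gaps k : admissible k ->
  (size (gaps k)).*2%:Z = (wmax k)%:Z - (cpd k 0)%:Z + 1.
Proof.
move=> gk; have := size_gaps gk; set G := size _ => h.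
have : (G.*2 + cpd k 0)%N = (wmax k + 1)%N.
  apply/eqP; rewrite -(eqr_nat rat) !natrD -mul2n natrM h.
  by apply/eqP; field.
by lia.
Qed.

(** Complementation in 0, ..., N, to pass from the semigroup elements, which index a basis, to the
    gaps, whose sum is known. *)
Lemma sum_nongaps k N : let ss := [seq s <- iota 0 N.+1 | in_sg k s] in
  let gs := [seq s <- iota 0 N.+1 | ~~ in_sg k s] in
  \sum_(s <- ss) (N%:R - s%:R) - \sum_(0 <= j < size ss) j%:R =
  N%:R * (N%:R + 1) / 2 - (N%:R * (size gs)%:R - \sum_(s <- gs) s%:R)
  - (N%:R + 1 - (size gs)%:R) * (N%:R - (size gs)%:R) / 2 :> rat.
Proof.
move=> ss gs; have sz : (size ss + size gs)%N = N.+1.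
  by rewrite !size_filter count_predC size_iota.
have e1 : \sum_(s <- gs) (N%:R - s%:R) = N%:R * (size gs)%:R - \sum_(s <- gs) s%:R :> rat.
  by rewrite sumrB big_const_seq count_predT iter_addr_0 mulr_natr.
have e2 : \sum_(s <- ss) (N%:R - s%:R) + \sum_(s <- gs) (N%:R - s%:R) =
    N%:R * (N%:R + 1) / 2 :> rat.
  rewrite !big_filter -(bigID (in_sg k) xpredT) -{1}(subn0 N.+1) -/(index_iota 0 N.+1).
  rewrite sumrB sum_iota1 sumr_const_nat subn0 -[_ *+ N.+1]mulr_natr -natr1.
  by field.
have e3 : (size ss)%:R = N%:R + 1 - (size gs)%:R :> rat.
  by rewrite natr1 -sz natrD addrK.
by rewrite -e1 -e2 addrK sum_iota1 e3; field.
Qed.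

Lemma gaps_below k N : admissible k -> (wmax k <= N + cpd k 0)%N ->
  perm_eq (gaps k) [seq s <- iota 0 N.+1 | ~~ in_sg k s].
Proof.
move=> gk le; apply: uniq_perm; rewrite ?filter_uniq ?iota_uniq // => n.
rewrite mem_gaps // mem_filter mem_iota /=; case: (boolP (in_sg k n)) => //= h.
by have := gaps_le gk h; lia.
Qed.

(** The case q = 1: the bound N = 2 G - 2 falls one short of the Frobenius number 2 G - 1, so
    exactly one gap is missed. This accounts for the term - S_0 in the weight. *)
Lemma gaps_below_frobenius k N : admissible k -> wmax k = (N.+1 + cpd k 0)%N ->
  perm_eq (gaps k) (N.+1 :: [seq s <- iota 0 N.+1 | ~~ in_sg k s]).
Proof.
move=> gk e; have fg : ~~ in_sg k N.+1.
  by have := frobenius_gap gk; rewrite e addnK; apply; rewrite leq_addl.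
apply: uniq_perm; rewrite ?cons_uniq ?filter_uniq ?iota_uniq ?andbT //.
  by rewrite mem_filter mem_iota /= add0n ltnn andbF.
move=> n; rewrite mem_gaps // inE mem_filter mem_iota /=.
have [->|ne] := eqVneq n N.+1; first by rewrite fg.
case: (boolP (in_sg k n)) => //= h; have := gaps_le gk h; lia.
Qed.

End CompoundSemigroup.

(** * The gap count as S_0 *)

Section CompoundSeq.
Variables A B : seq nat.
Let a := nth 0%N A.
Let b := nth 0%N B.
Hypothesis gAB : admissible a b (size A).

Lemma compoundE i : (i <= size A)%N -> compound A B i = cpd a b (size A) i.
Proof.
elim: i => [|i IH] iA; first by rewrite /= cpd0 (big_nth 0%N).
rewrite /= IH 1?ltnW // -cpd_step // mulnK //.
by case: gAB => ha _ _; apply: ha.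
Qed.

Lemma representableE n : representable A B n <-> in_sg a b (size A) n.
Proof.
split=> [[c ->]|/in_sg_lincombP[] // e ->].
  apply/in_sg_lincombP => //; exists (fun i => c (inord i)).
  apply: eq_bigr => i _; rewrite inord_val compoundE //; exact: ltn_ord i.
by exists e; apply: eq_bigr => i _; rewrite compoundE //; exact: ltn_ord i.
Qed.

Lemma S0E : S0 A B = size (gaps a b (size A)).
Proof.
have E : (fun n => ~ representable A B n) = [set` gaps a b (size A)]%classic.
  apply/funext => n; apply/propext; rewrite /= mem_gaps //.
  by split=> [h|/negP h /representableE//]; apply/negP => /representableE.
rewrite /S0 E.
have -> : [set` gaps a b (size A)]%classic =
    [set` [fset n in gaps a b (size A)]%fset]%classic.
  by apply/seteqP; split=> n /=; rewrite inE.
by rewrite set_fsetK card_fseq undup_id // filter_uniq // iota_uniq.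
Qed.

End CompoundSeq.

(** * The squared data and the numerical value of the weight *)

Section CompoundSquare.
Variables A B : seq nat.
Let a := nth 0%N A.
Let b := nth 0%N B.
Hypothesis gAB : admissible a b (size A).

Let nth_sqr (C : seq nat) i : nth 0%N (sqr_seq C) i = (nth 0%N C i ^ 2)%N.
Proof.
case: (ltnP i (size C)) => h; first by rewrite (nth_map 0%N).
by rewrite !nth_default // size_map.
Qed.

Lemma admissible_sqr : admissible (nth 0%N (sqr_seq A)) (nth 0%N (sqr_seq B)) (size (sqr_seq A)).
Proof.
case: gAB; rewrite size_map => ha hb hc; split=> [i ik|i ik|i j ik jk];
  rewrite !nth_sqr ?expn_gt0 ?ha ?hb //.
by rewrite coprimeXl // coprimeXr // hc.
Qed.

Lemma cpd_sqr k i : cpd (nth 0%N (sqr_seq A)) (nth 0%N (sqr_seq B)) k i = (cpd a b k i ^ 2)%N.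
Proof.
rewrite /cpd expnMn; congr (_ * _)%N.
  by rewrite (big_morph _ (fun x y => expnMn x y 2) (exp1n 2)); apply: eq_bigr.
by rewrite (big_morph _ (fun x y => expnMn x y 2) (exp1n 2)); apply: eq_bigr.
Qed.

(** Squaring every a and b turns the recursion of [wmax] into that of [wvar]; the squared pair
    enters the formula here. *)
Lemma wmax_sqr : (wmax (nth 0%N (sqr_seq A)) (nth 0%N (sqr_seq B)) (size A))%:R
  = wvar a b (size A).
Proof.
have := admissible_sqr; rewrite size_map.
elim: (size A) => [|k IH] gk //.
rewrite wmaxS // IH /=; last exact: admissibleW.
rewrite -(cpdkk (nth 0%N (sqr_seq A))) cpd_sqr cpdkk !nth_sqr.
by rewrite !natrX.
Qed.

Lemma S0_sqr : (S0 (sqr_seq A) (sqr_seq B))%:R = 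
  12 * \sum_(n <- gaps a b (size A)) (n%:R : rat) - 6 * (S0 A B)%:R * ((S0 A B)%:R - 1).
Proof.
rewrite !S0E ?sum_gaps ?size_gaps //; try exact: admissible_sqr.
by rewrite size_map wmax_sqr cpd_sqr natrX; ring.
Qed.

Lemma weight_count q N : (0 < q)%N -> (2 <= S0 A B)%N -> N = (q * (S0 A B).*2.-2)%N ->
  let ss := [seq s <- iota 0 N.+1 | in_sg a b (size A) s] in
  \sum_(s <- ss) (N%:R - s%:R) - \sum_(0 <= j < size ss) j%:R =
  (if q == 1%N then (S0 (sqr_seq A) (sqr_seq B))%:R / 12 - (S0 A B)%:R
   else (S0 (sqr_seq A) (sqr_seq B))%:R / 12) :> rat.
Proof.
move=> q0; have := twice_size_gaps gAB; have := S0E gAB.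
rewrite S0_sqr -/a -/b; set G := S0 A B => <- eG G2 eN ss; rewrite sum_nongaps.
have sG : size (gaps a b (size A)) = G by rewrite /G S0E.
set gs := filter _ _; have [q1|q1] := eqVneq q 1%N.
  have N1 : N.+1 = (G + G - 1)%N by rewrite eN q1; lia.
  have pg : perm_eq (gaps a b (size A)) (N.+1 :: gs).
    by apply: gaps_below_frobenius => //; move: eG; lia.
  rewrite (perm_big _ pg) big_cons /=.
  have := perm_size pg; rewrite sG /= => gG.
  have eNr : N%:R = 2 * G%:R - 2 :> rat.
    have -> : (2 : rat) * G%:R - 2 = (G + G - 1)%N%:R - 1.
      by rewrite natrB ?natrD; [ring|lia].
    by rewrite -N1 -natr1 addrK.
  have -> : (size gs)%:R = G%:R - 1 :> rat by rewrite gG -natr1 addrK.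
  by rewrite -[N.+1%:R]natr1 eNr; field.
(* For q >= 2 one has N >= 4 G - 4, which reaches the Frobenius number 2 G - 1 because G >= 2; no
   gap is missed. *)
have pg : perm_eq (gaps a b (size A)) gs.
  apply: gaps_below => //.
  suff : (G + G <= N + 1)%N by move: eG; lia.
  have : (2 * (G + G - 2) <= N)%N.
    by rewrite eN -addnn -subn2 leq_mul2r; apply/orP; right; lia.
  by lia.
rewrite (perm_big _ pg) /=; have := perm_size pg; rewrite sG => <-.
by field.
Qed.

End CompoundSquare.

(** * Orders at a point of the model *)

Section Valuation.
Variables (F K : fieldType) (iota : {rmorphism F -> K}) (P : curve_point iota).

Definition vge (n : int) (z : K) := z = 0 \/ n <= P z.

Lemma val1 : P 1 = 0.
Proof. by rewrite -(rmorph1 iota) ord_const ?oner_neq0. Qed.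

Lemma valN z : P (- z) = P z.
Proof.
have [->|z0] := eqVneq z 0; first by rewrite oppr0.
rewrite -mulN1r ord_mul ?oppr_eq0 ?oner_neq0 //.
by rewrite -(rmorphN1 iota) ord_const ?add0r ?oppr_eq0 ?oner_neq0.
Qed.

Lemma valX z n : z != 0 -> P (z ^+ n) = n%:Z * P z.
Proof.
move=> z0; elim: n => [|n IH]; first by rewrite expr0 val1 mul0r.
by rewrite exprS ord_mul ?expf_neq0 // IH; lia.
Qed.

Lemma valV z : z != 0 -> P z^-1 = - P z.
Proof.
move=> z0; apply/eqP; rewrite -addr_eq0 -ord_mul ?invr_eq0 //.
by rewrite mulVf // val1.
Qed.

Lemma vge0 n : vge n 0. Proof. by left. Qed.

Lemma vgeW n m z : n <= m -> vge m z -> vge n z.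
Proof. by move=> nm [->|h]; [left|right; apply: le_trans h]. Qed.

Lemma vgeN n z : vge n z -> vge n (- z).
Proof. by case=> [->|h]; [left; rewrite oppr0|right; rewrite valN]. Qed.

Lemma vgeD n z w : vge n z -> vge n w -> vge n (z + w).
Proof.
have [->|z0] := eqVneq z 0; first by rewrite add0r.
have [->|w0] := eqVneq w 0; first by rewrite addr0.
have [->|zw0] := eqVneq (z + w) 0; first by left.
move=> [/eqP|hz]; first by rewrite (negPf z0).
move=> [/eqP|hw]; first by rewrite (negPf w0).
by right; apply: le_trans (ord_add P z0 w0 zw0); rewrite le_min hz.
Qed.

Lemma vgeB n z w : vge n z -> vge n w -> vge n (z - w).
Proof. by move=> hz /vgeN; apply: vgeD. Qed.

Lemma vgeM n m z w : vge n z -> vge m w -> vge (n + m) (z * w).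
Proof.
have [->|z0] := eqVneq z 0; first by rewrite mul0r => *; left.
have [->|w0] := eqVneq w 0; first by rewrite mulr0 => *; left.
move=> [/eqP|hz]; first by rewrite (negPf z0).
move=> [/eqP|hw]; first by rewrite (negPf w0).
by right; rewrite ord_mul // lerD.
Qed.

Lemma vge_const c : vge 0 (iota c).
Proof.
have [->|c0] := eqVneq c 0; first by rewrite rmorph0; left.
by right; rewrite ord_const.
Qed.

Lemma vge1 : vge 0 1. Proof. by rewrite -(rmorph1 iota); exact: vge_const. Qed.

Lemma vgeMr n z w : vge n z -> vge 0 w -> vge n (z * w).
Proof. by move=> hz hw; rewrite -[n]addr0; apply: vgeM. Qed.

Lemma vgeMl n z w : vge 0 z -> vge n w -> vge n (z * w).
Proof. by move=> hz hw; rewrite -[n]add0r; apply: vgeM. Qed.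

Lemma vgeX z n : vge 0 z -> vge 0 (z ^+ n).
Proof. by move=> hz; elim: n => [|n IH]; rewrite ?exprS; [exact: vge1|exact: vgeMr]. Qed.

Lemma vge_sum (I : Type) (r : seq I) (Q : pred I) n (G : I -> K) :
  (forall i, Q i -> vge n (G i)) -> vge n (\sum_(i <- r | Q i) G i).
Proof. by move=> h; elim/big_ind: _ => // [|u v]; [left|exact: vgeD]. Qed.

Lemma vge_prod (I : Type) (r : seq I) (Q : pred I) (G : I -> K) :
  (forall i, Q i -> vge 0 (G i)) -> vge 0 (\prod_(i <- r | Q i) G i).
Proof. by move=> h; elim/big_ind: _ => // [|u v]; [exact: vge1|exact: vgeMr]. Qed.

Lemma vgeE n z : z != 0 -> vge n z <-> n <= P z.
Proof. by move=> z0; split; [case=> // /eqP; rewrite (negPf z0)|right]. Qed.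

(** The term of strictly least order decides. The upper bound on the order of the sum comes from the
    ultrametric inequality for z = (z + w) - w; the form with [vge] lets w be 0. *)
Lemma val_dom z w : z != 0 -> vge (P z + 1) w -> z + w != 0 /\ P (z + w) = P z.
Proof.
move=> z0; have [->|w0] := eqVneq w 0; first by rewrite addr0.
move/(vgeE _ w0) => h.
have zw0 : z + w != 0.
  by apply/eqP => /eqP; rewrite addr_eq0 => /eqP e; move: h; rewrite e valN; lia.
split=> //; apply/eqP; rewrite eq_le; apply/andP; split; last first.
  apply: le_trans (ord_add P z0 w0 zw0); rewrite le_min lexx /=; lia.
have := @ord_add _ _ _ P (z + w) (- w) zw0; rewrite addrK oppr_eq0 valN => /(_ w0 z0).
by rewrite ge_min => /orP[//|]; lia.
Qed.

Lemma val_prod (I : Type) (r : seq I) (Q : pred I) (G : I -> K) :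
  (forall i, Q i -> G i != 0) ->
  P (\prod_(i <- r | Q i) G i) = \sum_(i <- r | Q i) P (G i).
Proof.
move=> h; suff [] : \prod_(i <- r | Q i) G i != 0 /\
   P (\prod_(i <- r | Q i) G i) = \sum_(i <- r | Q i) P (G i) by [].
elim/big_ind2: _ => [|u u' v v' [u0 <-] [v0 <-]|i Qi]; last by split; rewrite ?h.
  by rewrite oner_neq0 val1.
by rewrite mulf_neq0 // ord_mul.
Qed.

Lemma vge_horner (p : {poly F}) z : vge 0 z -> vge 0 (map_poly iota p).[z].
Proof.
move=> hz; rewrite horner_coef; apply: vge_sum => i _.
by rewrite coef_map /=; apply: vgeMr; [exact: vge_const|exact: vgeX].
Qed.

Lemma val_horner_pole (p : {poly F}) z : z != 0 -> P z < 0 -> p != 0 ->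
  (map_poly iota p).[z] != 0 /\ P (map_poly iota p).[z] = ((size p).-1)%:Z * P z.
Proof.
move=> z0 zn; elim/poly_ind: p => [|p c IH]; first by rewrite eqxx.
rewrite rmorphD /= rmorphM /= map_polyX map_polyC /= !hornerE.
have [->|p0] := eqVneq p 0.
  rewrite mul0r add0r rmorph0 horner0 mul0r add0r polyC_eq0 => c0.
  by rewrite fmorph_eq0 c0 ord_const // size_polyC c0 mul0r.
move=> _; have [h1 h2] := IH p0.
rewrite -cons_poly_def size_cons_poly nil_poly (negPf p0) /=.
have h3 : P ((map_poly iota p).[z] * z) = (size p)%:Z * P z.
  rewrite ord_mul // h2; have : (0 < size p)%N by rewrite size_poly_gt0.
  by case: (size p) => // n _; lia.
have [] := @val_dom ((map_poly iota p).[z] * z) (iota c).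
- by rewrite mulf_neq0.
- apply: vgeW (vge_const c); rewrite h3.
  have : (0 < size p)%N by rewrite size_poly_gt0.
  by nia.
by rewrite h3.
Qed.

End Valuation.

(** * Pole orders of the coordinates at infinity *)

Section Tower.
Variables (F : numClosedFieldType) (K : fieldType) (iota : {rmorphism F -> K}).
Variables (k : nat) (a b : nat -> nat) (f : nat -> {poly F}) (x : nat -> K).
Hypothesis gab : admissible a b k.
Hypothesis f_size : forall i, (i < k)%N -> size (f i) = (b i).+1.
Hypothesis tower : forall i, (i < k)%N ->
  x i.+1 ^+ a i = (map_poly iota (f i)).[x i].

Local Notation g := (cpd a b k).

Let a_gt0 i : (i < k)%N -> (0 < a i)%N. Proof. by case: gab => h _ _; apply: h. Qed.
Let b_gt0 i : (i < k)%N -> (0 < b i)%N. Proof. by case: gab => _ h _; apply: h. Qed.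
Let g_gt0 i : (i <= k)%N -> (0 < g i)%N. Proof. exact: cpd_gt0. Qed.
Let f_neq0 i : (i < k)%N -> f i != 0.
Proof. by move=> ik; rewrite -size_poly_gt0 f_size. Qed.

Definition at_inf (P : curve_point iota) := exists2 i, (i <= k)%N & ~ vge P 0 (x i).

(** A root of a regular function is regular. Hence x_0 alone decides whether a point is affine, and
    from here on [vge P 0 (x 0)] expresses it. *)
Lemma affine_coord (P : curve_point iota) : vge P 0 (x 0) ->
  forall i, (i <= k)%N -> vge P 0 (x i).
Proof.
move=> h0; elim=> // i IH ik.
have [->|x0] := eqVneq (x i.+1) 0; first by left.
have := vge_horner (f i) (IH (ltnW ik)); rewrite -tower // => h.
right; move: h; rewrite vgeE ?expf_neq0 // valX //.
by have := a_gt0 ik; nia.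
Qed.

Lemma inf_coord0 P : at_inf P -> x 0 != 0 /\ P (x 0) < 0.
Proof.
case=> i ik hi; have h : ~ vge P 0 (x 0) by move/affine_coord => /(_ i ik).
split; first by apply/eqP => e; apply: h; left.
by rewrite ltNge; apply/negP => e; apply: h; right.
Qed.

(** Comparing orders in the equation of index i gives a_i ord x_{i+1} = b_i ord x_i, the recursion
    of the compound sequence; only the ratios of the orders are determined. *)
Lemma inf_coord P i : at_inf P -> (i <= k)%N ->
  [/\ x i != 0, P (x i) < 0 & P (x i) * (g 0)%:Z = P (x 0) * (g i)%:Z].
Proof.
move=> hP; elim: i => [|i IH] ik.
  by have [] := inf_coord0 hP.
have [x0 xn e] := IH (ltnW ik).
have [h1 h2] := val_horner_pole x0 xn (f_neq0 ik).
move: h1 h2; rewrite -tower // expf_eq0 (a_gt0 ik) /= => h1.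
rewrite valX // f_size //= => h2; split=> //.
  by have := b_gt0 ik; have := a_gt0 ik; nia.
have := cpd_step a b ik => gs.
have a0 : ((a i)%:Z != 0) by have := a_gt0 ik; lia.
apply: (mulfI a0); rewrite mulrA h2 -mulrA e.
have -> : (a i)%:Z * (P (x 0) * (g i.+1)%:Z) = P (x 0) * (g i.+1 * a i)%N%:Z.
  by rewrite PoszM; ring.
by rewrite gs PoszM; ring.
Qed.

(** From ord(x_k) g_0 = ord(x_0) g_k and the coprimality of g_0 and g_k, g_0 divides ord x_0. *)
Lemma inf_scale P : at_inf P -> exists2 e : nat, (0 < e)%N &
  forall i, (i <= k)%N -> P (x i) = - (e * g i)%N%:Z.
Proof.
move=> hP; have [_ n0 _] := inf_coord hP (leq0n k).
have [_ nk ek] := inf_coord hP (leqnn k).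
have g0 := g_gt0 (leq0n k).
have : (g 0 %| `|P (x 0)|)%N.
  rewrite -(@Gauss_dvdl _ _ (g k)) ?coprime_cpd //.
  have := congr1 absz ek; rewrite !abszM /= => <-; exact: dvdn_mull.
case/dvdnP => e ee; have e0 : P (x 0) = - (e * g 0)%N%:Z by rewrite -ee; lia.
exists e; first by case: e e0 {ee} => // e0; move: n0; rewrite e0; lia.
move=> i ik; have [_ _] := inf_coord hP ik; rewrite e0 => h.
have g0' : (g 0)%:Z != 0 by lia.
by apply: (mulIf g0'); rewrite h !PoszM; ring.
Qed.

(** * Normal forms in the coordinate ring *)

Definition xv (i : 'I_k.+1) : K := x i.
Local Notation ev := (mmap iota xv).

Definition mnm_fun (m : 'X_{1..k.+1}) (i : nat) : nat := m (inord i).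
Definition wdeg (m : 'X_{1..k.+1}) := lincomb a b k (mnm_fun m).
(* The rewriting step x_{i+1}^(a_i) -> f_i(x_i) preserves wdeg on leading
   monomials and decreases mu. *)
Definition mu (m : 'X_{1..k.+1}) := (\sum_(i < k.+1) m i * (i * g i))%N.

Lemma wdegE m : wdeg m = (\sum_(i < k.+1) m i * g i)%N.
Proof. by apply: eq_bigr => i _; rewrite /mnm_fun inord_val. Qed.

Lemma wdegDU m (i : 'I_k.+1) l : wdeg (m + U_(i) *+ l)%MM = (wdeg m + l * g i)%N.
Proof.
rewrite !wdegE; under eq_bigr => j _ do rewrite mnmDE mulmnE mnm1E mulnDl.
rewrite big_split /=; congr (_ + _)%N; rewrite (bigD1 i) //= eqxx mul1n big1 ?addn0 //.
by move=> j ji; rewrite eq_sym (negPf ji) !mul0n.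
Qed.

Lemma muDU m (i : 'I_k.+1) l : mu (m + U_(i) *+ l)%MM = (mu m + l * (i * g i))%N.
Proof.
rewrite /mu; under eq_bigr => j _ do rewrite mnmDE mulmnE mnm1E mulnDl.
rewrite big_split /=; congr (_ + _)%N; rewrite (bigD1 i) //= eqxx mul1n big1 ?addn0 //.
by move=> j ji; rewrite eq_sym (negPf ji) !mul0n.
Qed.

Definition normal_mon (s : nat) : 'X_{1..k.+1} :=
  xget 0%MM [set m | normal a k (mnm_fun m) /\ wdeg m = s]%classic.

Lemma normal_mon_uniq m : normal a k (mnm_fun m) -> normal_mon (wdeg m) = m.
Proof.
move=> nm; rewrite /normal_mon; case: xgetP => [m' _ [nm' e]|/(_ m)]; last by case.
apply/mnmP => i; have := lincomb_inj gab nm' nm e (i := i).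
by rewrite /mnm_fun inord_val; apply; rewrite -ltnS.
Qed.

(** A univariate polynomial encodes a normal form: its coefficient at s belongs to the normal
    monomial of weight s, so its degree will be the pole order. Exponents outside the semigroup,
    where [normal_mon] may take its default value, are excluded. *)
Definition supported (c : {poly F}) := forall s, c`_s != 0 -> in_sg a b k s.
Definition normal_poly (c : {poly F}) : {mpoly F[k.+1]} :=
  \sum_(s < size c) c`_s *: 'X_[normal_mon s].

Lemma normal_polyE (c : {poly F}) N : (size c <= N)%N ->
  normal_poly c = \sum_(s < N) c`_s *: 'X_[normal_mon s].
Proof.
move=> cN; rewrite /normal_poly (big_ord_widen _ (fun s => c`_s *: 'X_[normal_mon s]) cN).
rewrite big_mkcond; apply: eq_bigr => s _; case: ltnP => // h.
by rewrite nth_default // scale0r.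
Qed.

Lemma normal_polyD c d : normal_poly (c + d) = normal_poly c + normal_poly d.
Proof.
pose N := maxn (size c) (size d).
rewrite !(@normal_polyE _ N) ?leq_maxl ?leq_maxr ?size_polyD // -big_split.
by apply: eq_bigr => i _; rewrite coefD scalerDl.
Qed.

Lemma normal_polyZ u c : normal_poly (u *: c) = u *: normal_poly c.
Proof.
rewrite !(@normal_polyE _ (size c)) ?size_scale_leq // scaler_sumr.
by apply: eq_bigr => i _; rewrite coefZ scalerA.
Qed.

Definition tower_poly (i : nat) : {mpoly F[k.+1]} := 'X_(inord i.+1) ^+ a i
  - \sum_(l < (b i).+1) (f i)`_l *: 'X_(inord i) ^+ l.

Section Reduction.
Variable J : {mpoly F[k.+1]} -> Prop.
Hypothesis J0 : J 0.
Hypothesis JD : forall p q, J p -> J q -> J (p + q).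
Hypothesis JM : forall p q, J p -> J (q * p).
Hypothesis Jt : forall i, (i < k)%N -> J (tower_poly i).

Let rep p := exists2 c, supported c & J (p - normal_poly c).

Let repD p q : rep p -> rep q -> rep (p + q).
Proof.
move=> [c sc jc] [d sd jd]; exists (c + d).
  move=> s; rewrite coefD; have [e|h _] := eqVneq c`_s 0; last exact: sc.
  by rewrite e add0r; exact: sd.
by rewrite normal_polyD opprD addrACA; apply: JD.
Qed.

Let repZ u p : rep p -> rep (u *: p).
Proof.
move=> [c sc jc]; exists (u *: c).
  by move=> s; rewrite coefZ mulf_eq0 negb_or => /andP[_]; exact: sc.
by rewrite normal_polyZ -scalerBr -mul_mpolyC; apply: JM.
Qed.

Let repJ p q : J (p - q) -> rep q -> rep p.
Proof. by move=> h [c sc jc]; exists c => //; rewrite -[p](subrK q) -addrA; apply: JD. Qed.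

Let rep_sum I (r : seq I) (G : I -> {mpoly F[k.+1]}) :
  (forall i, rep (G i)) -> rep (\sum_(i <- r) G i).
Proof.
move=> h; elim/big_ind: _ => //.
exists 0; first by move=> s; rewrite coef0 eqxx.
by rewrite /normal_poly size_poly0 big_ord0 subrr.
Qed.

(** Lexicographic induction on [wdeg], then [mu]. As [mu] is weight multiplied by index, it drops
    when weight moves from index i + 1 to index i. *)
Let rep_mon m : rep 'X_[m].
Proof.
move: {2}(wdeg m) (erefl (wdeg m)) => s.
elim/ltn_ind: s m => s IHs m.
move: {2}(mu m) (erefl (mu m)) => u.
elim/ltn_ind: u m => u IHu m em ew.
have [nm|] := pselect (normal a k (mnm_fun m)).
  exists 'X^s.
    move=> t; rewrite coefXn; have [-> _|_] := eqVneq t s; last by rewrite eqxx.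
    by apply/in_sg_lincombP => //; exists (mnm_fun m).
  rewrite /normal_poly size_polyXn big_ord_recr /= big1 ?add0r.
    by rewrite coefXn eqxx scale1r -ew normal_mon_uniq // subrr.
  by move=> i _; rewrite coefXn ltn_eqF // scale0r.
move=> nn; have [i ik am] : exists2 i, (i < k)%N & (a i <= m (inord i.+1))%N.
  apply: contrapT => h; apply: nn => i ik; rewrite ltnNge; apply/negP => e.
  by apply: h; exists i.
pose m0 := (m - U_(inord i.+1) *+ a i)%MM.
have mE : m = (m0 + U_(inord i.+1) *+ a i)%MM.
  rewrite /m0 submK //; apply/mnm_lepP => j; rewrite mulmnE mnm1E.
  by case: eqP => [<-|_]; rewrite ?mul1n ?mul0n.
have iS : (inord i.+1 : 'I_k.+1) = i.+1 :> nat by rewrite inordK.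
have iO : (inord i : 'I_k.+1) = i :> nat by rewrite inordK // ltnS ltnW.
have gs := cpd_step a b ik.
apply: (@repJ _ (\sum_(l < (b i).+1) (f i)`_l *: 'X_[m0 + U_(inord i) *+ l])).
  have -> : 'X_[m] - \sum_(l < (b i).+1) (f i)`_l *: 'X_[m0 + U_(inord i) *+ l]
     = 'X_[m0] * tower_poly i.
    rewrite {1}mE mpolyXD -mpolyXn /tower_poly mulrBr mulr_sumr; congr (_ - _).
    by apply: eq_bigr => l _; rewrite mpolyXD -mpolyXn scalerAr.
  exact/JM/Jt.
apply: rep_sum => l; apply: repZ.
have wl : wdeg (m0 + U_(inord i) *+ l)%MM = (wdeg m0 + l * g i)%N by rewrite wdegDU iO.
have wm : wdeg m = (wdeg m0 + b i * g i)%N by rewrite {1}mE wdegDU iS mulnC gs mulnC.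
have lb : (l <= b i)%N by rewrite -ltnS.
have g0 := g_gt0 (ltnW ik).
(* The leading term of f_i keeps the weight and lowers [mu] by b_i g_i; every other term lowers the
   weight. *)
have [e|ne] := eqVneq (l : nat) (b i).
  apply: (IHu (mu (m0 + U_(inord i) *+ l)%MM)) => //; last by rewrite wl e -wm.
  rewrite -em mE !muDU iS iO e.
  have -> : (a i * (i.+1 * g i.+1) = i.+1 * (b i * g i))%N.
    by rewrite mulnCA (mulnC (a i)) gs (mulnC (g i)).
  by rewrite ltn_add2l mulnCA mulSn -{1}[(i * _)%N]add0n ltn_add2r muln_gt0 b_gt0.
apply: (IHs (wdeg (m0 + U_(inord i) *+ l)%MM)) => //.
by rewrite wl -ew wm ltn_add2l ltn_pmul2r // ltn_neqAle ne lb.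
Qed.

Lemma reduction p : exists2 c, supported c & J (p - normal_poly c).
Proof.
rewrite -/(rep p) [p]mpolyE; apply: rep_sum => m; apply: repZ; exact: rep_mon.
Qed.

End Reduction.

Lemma normal_monP s : in_sg a b k s ->
  normal a k (mnm_fun (normal_mon s)) /\ wdeg (normal_mon s) = s.
Proof.
case/(in_sg_normal gab) => e ne es; pose m : 'X_{1..k.+1} := [multinom e i | i < k.+1].
have me i : (i <= k)%N -> mnm_fun m i = e i by move=> ik; rewrite /mnm_fun mnmE inordK.
have nm : normal a k (mnm_fun m) by move=> i ik; rewrite me ?ne.
have wm : wdeg m = s.
  by rewrite es; apply: eq_bigr => i _; rewrite me // -ltnS.
by rewrite -wm normal_mon_uniq.
Qed.

Lemma mmap1_neq0 P m : at_inf P -> mmap1 xv m != 0.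
Proof.
move=> hP; rewrite /mmap1; apply/prodf_neq0 => i _; rewrite expf_neq0 //.
by have [] := inf_coord hP (ltn_ord i : i <= k)%N.
Qed.

Lemma val_mmap1 P e m : at_inf P ->
  (forall i, (i <= k)%N -> P (x i) = - (e * g i)%N%:Z) ->
  P (mmap1 xv m) = - (e * wdeg m)%N%:Z.
Proof.
move=> hP he; have x0 i : (i <= k)%N -> x i != 0 by case/(inf_coord hP).
rewrite /mmap1 val_prod => [|i _]; last by rewrite expf_neq0 // x0 //; exact: ltn_ord i.
rewrite wdegE big_distrr /= (big_morph _ PoszD (erefl 0%:Z)) -sumrN.
apply: eq_bigr => i _; have ik : (i <= k)%N := ltn_ord i.
by rewrite valX ?x0 // he // !PoszM; ring.
Qed.

(** Normal monomials of distinct weights have distinct orders, so the top one dominates. The factor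
    [e] is carried along because its being 1 is deduced from this lemma, in [inf_val]. *)
Lemma val_normal_poly P e c : at_inf P ->
  (forall i, (i <= k)%N -> P (x i) = - (e * g i)%N%:Z) -> (0 < e)%N ->
  supported c -> c != 0 ->
  ev (normal_poly c) != 0 /\ P (ev (normal_poly c)) = - (e * (size c).-1)%N%:Z.
Proof.
move=> hP he e0 sc c0.
have sz : size c = (size c).-1.+1 by rewrite prednK // size_poly_gt0.
have vm s : in_sg a b k s -> P (mmap1 xv (normal_mon s)) = - (e * s)%N%:Z.
  by move=> ss; rewrite (val_mmap1 _ hP he); have [_ ->] := normal_monP ss.
rewrite /normal_poly sz big_ord_recr /= rmorphD /= addrC mmapZ mmapX.
rewrite -/(lead_coef c).
have lc0 : lead_coef c != 0 by rewrite lead_coef_eq0.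
have cs : in_sg a b k (size c).-1 by apply: sc.
have h0 : iota (lead_coef c) * mmap1 xv (normal_mon (size c).-1) != 0.
  by rewrite mulf_neq0 ?fmorph_eq0 // (mmap1_neq0 _ hP).
have hv : P (iota (lead_coef c) * mmap1 xv (normal_mon (size c).-1)) = - (e * (size c).-1)%N%:Z.
  by rewrite ord_mul ?fmorph_eq0 ?(mmap1_neq0 _ hP) // ord_const // add0r vm.
have [] := val_dom (P := P) (w := ev (\sum_(i < (size c).-1) c`_i *: 'X_[normal_mon i])) h0.
  rewrite rmorph_sum /=; apply: vge_sum => i _; rewrite mmapZ mmapX.
  have [->|ci] := eqVneq c`_i 0; first by rewrite rmorph0 mul0r; left.
  apply: vgeMl; first exact: vge_const.
  right; rewrite hv vm; last exact: sc.
  have : (e * i.+1 <= e * (size c).-1)%N by rewrite leq_mul2l ltn_ord orbT.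
  by rewrite mulnS; lia.
by rewrite hv.
Qed.

(* Maximal minors of the Jacobian matrix, up to sign. *)
Definition tangent (i : nat) : K := \prod_(l < i) (map_poly iota (f l)^`()).[x l]
  * \prod_(i <= l < k) ((a l)%:R * x l.+1 ^+ (a l).-1).

(** The row of index i of the Jacobian kills the vector of minors. *)
Lemma tangent_step i : (i < k)%N ->
  (a i)%:R * x i.+1 ^+ (a i).-1 * tangent i.+1 = (map_poly iota (f i)^`()).[x i] * tangent i.
Proof. by move=> ik; rewrite /tangent big_ord_recr /= [in RHS]big_ltn //; ring. Qed.

(** * The derivation of K along the tangent field *)

Definition tder (p : {mpoly F[k.+1]}) : K := \sum_(j < k.+1) ev p^`M(j) * tangent j.

Lemma tderD p q : tder (p + q) = tder p + tder q.
Proof.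
rewrite -big_split; apply: eq_bigr => j _ /=.
by rewrite mderivD rmorphD mulrDl.
Qed.

Lemma tderN p : tder (- p) = - tder p.
Proof.
by rewrite -sumrN; apply: eq_bigr => j _; rewrite mderivN rmorphN mulNr.
Qed.

Lemma tderM p q : tder (p * q) = tder p * ev q + ev p * tder q.
Proof.
rewrite /tder mulr_suml mulr_sumr -big_split; apply: eq_bigr => j _ /=.
by rewrite mderivM rmorphD !rmorphM /=; ring.
Qed.

Lemma tderC c : tder c%:MP = 0.
Proof. by rewrite /tder big1 // => j _; rewrite mderivC rmorph0 mul0r. Qed.

Lemma tderZ c p : tder (c *: p) = iota c * tder p.
Proof. by rewrite -mul_mpolyC tderM tderC mul0r add0r mmapC. Qed.

Lemma tderXn p n : tder (p ^+ n) = n%:R * ev p ^+ n.-1 * tder p.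
Proof.
elim: n => [|n IH]; first by rewrite expr0 (tderC 1) !mul0r.
rewrite exprS tderM IH rmorphXn /=; case: n {IH} => [|n] /=.
  by rewrite !expr0 /=; ring.
by rewrite -(natr1 n.+1) !exprS; ring.
Qed.

Lemma tderU (i : 'I_k.+1) : tder 'X_i = tangent i.
Proof.
rewrite /tder (bigD1 i) //= big1 => [|j ji]; rewrite mderivX mnm1E.
  rewrite eqxx scale1r addr0 (_ : (U_(i) - U_(i))%MM = 0%MM).
    by rewrite mpolyX0 rmorph1 mul1r.
  by apply/mnmP => j; rewrite mnmBE mnm0E subnn.
by rewrite eq_sym (negPf ji) scale0r rmorph0 mul0r.
Qed.

Lemma tder_sum (I : Type) (r : seq I) (G : I -> {mpoly F[k.+1]}) :
  tder (\sum_(i <- r) G i) = \sum_(i <- r) tder (G i).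
Proof. by apply: (big_morph tder tderD); exact: (tderC 0). Qed.

Lemma evX i : (i <= k)%N -> ev 'X_(inord i) = x i.
Proof. by move=> ik; rewrite mmapX mmap1U /xv inordK. Qed.

Lemma ev_tower_poly i : (i < k)%N -> ev (tower_poly i) = 0.
Proof.
move=> ik; rewrite /tower_poly rmorphB rmorphXn /= evX // tower // rmorph_sum /=.
rewrite horner_coef size_map_poly f_size //; apply/eqP; rewrite subr_eq0; apply/eqP.
by apply: eq_bigr => l _; rewrite coef_map /= mmapZ rmorphXn /= evX // ltnW.
Qed.

Lemma tder_tower_poly i : (i < k)%N -> tder (tower_poly i) = 0.
Proof.
move=> ik; rewrite /tower_poly tderD tderN tderXn evX // tderU inordK // tangent_step //.
rewrite tder_sum (_ : \sum_(_ < _) _ = (map_poly iota (f i)^`()).[x i] * tangent i) ?subrr //.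
rewrite (@horner_coef_wide _ (b i)); last first.
  by rewrite size_map_poly (leq_trans (size_poly _ _)) // f_size.
rewrite mulr_suml big_ord_recl tderZ tderXn !mul0r mulr0 add0r.
apply: eq_bigr => l _; rewrite tderZ tderXn evX ?(ltnW ik) // tderU inordK ?ltnS ?(ltnW ik) //.
by rewrite !lift0 coef_map /= coef_deriv rmorphMn /= -[_ *+ _]mulr_natr; ring.
Qed.

Variable Pinf : curve_point iota.
Hypothesis Pinf_inf : at_inf Pinf.

(** The given point at infinity is the witness for linear independence of the normal monomials in
    K. *)
Lemma normal_poly_neq0 c : supported c -> c != 0 -> ev (normal_poly c) != 0.
Proof.
move=> sc c0; have [e e0 he] := inf_scale Pinf_inf.
by have [] := val_normal_poly Pinf_inf he e0 sc c0.
Qed.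

(* The reduction is done modulo the ideal where both ev and tder vanish: as normal
   forms are nonzero in K, this ideal is ker ev and tder factors through ev. *)
Lemma ev_normal_poly p : exists2 c, supported c &
  ev p = ev (normal_poly c) /\ tder p = tder (normal_poly c).
Proof.
have [||||c sc [h1 h2]] := @reduction (fun p => ev p = 0 /\ tder p = 0) _ _ _ _ p.
- by rewrite rmorph0 (tderC 0).
- by move=> u v [h1 h2] [h3 h4]; rewrite rmorphD tderD /= h1 h2 h3 h4 addr0.
- by move=> u v [h1 h2]; rewrite rmorphM tderM /= h1 h2 !mulr0 addr0.
- by move=> i ik; rewrite ev_tower_poly ?tder_tower_poly.
exists c => //; split; apply/eqP; rewrite -subr_eq0; apply/eqP.
  by rewrite -h1 rmorphB.
by rewrite -h2 tderD tderN.
Qed.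

Lemma tder_ker p : ev p = 0 -> tder p = 0.
Proof.
have [c sc [h1 ->]] := ev_normal_poly p; rewrite h1 => h.
have [->|c0] := eqVneq c 0; first by rewrite /normal_poly size_poly0 big_ord0 (tderC 0).
by have := normal_poly_neq0 sc c0; rewrite h eqxx.
Qed.

Hypothesis fracK : forall z, exists p r, ev r != 0 /\ z = ev p / ev r.

Lemma derivation_exists : exists D : K -> K, is_derivation iota D /\
  forall p, D (ev p) = tder p.
Proof.
have [num hn] := choice fracK; have [den hd] := choice hn.
pose D z := (tder (num z) - z * tder (den z)) / ev (den z).
have DE p r : ev r != 0 -> D (ev p / ev r) = (tder p - ev p / ev r * tder r) / ev r.
  move=> r0; rewrite /D; set z := ev p / ev r; have [s0 zs] := hd z.
  have zr : ev p = z * ev r by rewrite /z divfK.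
  have zs' : ev (num z) = z * ev (den z) by rewrite {2}zs divfK.
  (* Independence of the chosen fraction: the cross-multiplied relation lies in the kernel of [ev],
     so it may be differentiated. *)
  have : tder (p * den z - num z * r) = 0.
    by apply: tder_ker; rewrite rmorphB !rmorphM /= zr zs'; ring.
  rewrite tderD tderN !tderM zr zs' => h.
  apply: (mulIf (mulf_neq0 s0 r0)); rewrite mulrA divfK // [ev (den z) * _]mulrC mulrA divfK //.
  by apply/eqP; rewrite -subr_eq0 -oppr_eq0 -[X in _ == X]h; apply/eqP; ring.
exists D; split; last first.
  move=> p; have := @DE p 1; rewrite rmorph1 /= !divr1 (tderC 1) mulr0 subr0.
  by apply; exact: oner_neq0.
split=> [y z|y z|c].
- have [p [r [r0 ->]]] := fracK y; have [q [s [s0 ->]]] := fracK z.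
  have -> : ev p / ev r + ev q / ev s = ev (p * s + q * r) / ev (r * s).
    by rewrite rmorphD !rmorphM /=; field; rewrite r0 s0.
  rewrite !DE ?rmorphM ?mulf_neq0 //= rmorphD !tderD !rmorphM /= !tderM.
  by field; rewrite r0 s0.
- have [p [r [r0 ->]]] := fracK y; have [q [s [s0 ->]]] := fracK z.
  have -> : ev p / ev r * (ev q / ev s) = ev (p * q) / ev (r * s).
    by rewrite !rmorphM /=; field; rewrite r0 s0.
  rewrite !DE ?rmorphM ?mulf_neq0 //= !tderM.
  by field; rewrite r0 s0.
have := @DE c%:MP 1; rewrite rmorph1 mmapC /= !divr1 !tderC mulr0 subr0.
by apply; exact: oner_neq0.
Qed.

(** By the normal forms, [e] divides the order of every nonzero element of O, hence of K; but some
    element has order 1. *)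
Lemma inf_val P : at_inf P -> forall i, (i <= k)%N -> P (x i) = - (g i)%:Z.
Proof.
move=> hP; have [e e0 he] := inf_scale hP.
have dvO p : ev p != 0 -> (e%:Z %| P (ev p))%Z.
  have [c sc [-> _]] := ev_normal_poly p => h.
  have c0 : c != 0 by apply: contraNneq h => ->; rewrite /normal_poly size_poly0 big_ord0 rmorph0.
  have [_ ->] := val_normal_poly hP he e0 sc c0.
  by rewrite dvdzE abszN /= dvdn_mulr.
have [t [t0 t1]] := ord_unif P.
have [p [r [r0 ez]]] := fracK t.
have p0 : ev p != 0 by apply: contraNneq t0 => p0; rewrite ez p0 mul0r.
have : (e%:Z %| P t)%Z.
  by rewrite ez ord_mul ?invr_eq0 // valV // rpredB // dvO.
rewrite t1 dvdzE /= dvdn1 => /eqP e1 i ik.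
by rewrite he // e1 mul1n.
Qed.

Lemma val_inf P c : at_inf P -> supported c -> c != 0 ->
  P (ev (normal_poly c)) = - (size c).-1%:Z.
Proof.
move=> hP sc c0; have he i : (i <= k)%N -> P (x i) = - (1 * g i)%N%:Z.
  by move=> ik; rewrite mul1n inf_val.
by have [_ ->] := val_normal_poly hP he (ltn0Sn 0) sc c0; rewrite mul1n.
Qed.

Lemma natK_neq0 n : (0 < n)%N -> n%:R != 0 :> K.
Proof. by move=> n0; rewrite -(rmorph_nat iota) fmorph_eq0 pnatr_eq0 -lt0n. Qed.

Lemma x_neq0 i : (i <= k)%N -> x i != 0.
Proof. by case/(inf_coord Pinf_inf). Qed.

Lemma tangent0_neq0 : tangent 0 != 0.
Proof.
rewrite /tangent big_ord0 mul1r big_mkord; apply/prodf_neq0 => -[i ik] _ /=.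
by rewrite mulf_neq0 ?expf_neq0 ?x_neq0 ?natK_neq0 ?a_gt0.
Qed.

Section Derivation.
Variable E : K -> K.
Hypothesis hE : is_derivation iota E.

Let ED y z : E (y + z) = E y + E z. Proof. by case: hE. Qed.
Let EM y z : E (y * z) = E y * z + y * E z. Proof. by case: hE. Qed.
Let EC c : E (iota c) = 0. Proof. by case: hE. Qed.

Lemma der0 : E 0 = 0. Proof. by have := EC 0; rewrite rmorph0. Qed.
Lemma der1 : E 1 = 0. Proof. by rewrite -(rmorph1 iota) EC. Qed.

Lemma derV z : z != 0 -> E z^-1 = - E z / z ^+ 2.
Proof.
move=> z0; have := EM z z^-1; rewrite divff // der1 => /esym/eqP.
rewrite addrC addr_eq0 => /eqP h; apply: (mulfI z0); rewrite h.
by field.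
Qed.

Lemma derXn z n : E (z ^+ n) = n%:R * z ^+ n.-1 * E z.
Proof.
elim: n => [|n IH]; first by rewrite expr0 der1 !mul0r.
rewrite exprS EM IH; case: n {IH} => [|n] /=; first by rewrite expr0; ring.
by rewrite -(natr1 n.+1) !exprS; ring.
Qed.

Lemma der_horner (p : {poly F}) z :
  E (map_poly iota p).[z] = (map_poly iota p^`()).[z] * E z.
Proof.
elim/poly_ind: p => [|p c IH]; first by rewrite deriv0 !rmorph0 !horner0 der0 mul0r.
rewrite derivD derivM derivX derivC addr0 mulr1 !rmorphD !rmorphM /= map_polyX map_polyC /=.
by rewrite !hornerE ED EM EC IH; ring.
Qed.

(** In characteristic 0 the equation of index i determines E x_{i+1} from E x_i, as x_{i+1} is
    nonzero. *)
Lemma der_eq0 : E (x 0) = 0 -> forall z, E z = 0.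
Proof.
move=> E0.
have Ex i : (i <= k)%N -> E (x i) = 0.
  elim: i => // i IH ik; have := congr1 E (tower ik).
  rewrite der_horner IH 1?ltnW // mulr0 derXn => /eqP; rewrite !mulf_eq0.
  by rewrite (negPf (natK_neq0 (a_gt0 ik))) expf_eq0 (negPf (x_neq0 ik)) andbF => /eqP.
have Eev p : E (ev p) = 0.
  rewrite /mmap; elim/big_ind: _ => [|u v hu hv|m _]; first exact: der0.
    by rewrite ED hu hv addr0.
  rewrite EM EC mul0r add0r /mmap1; set y := \prod_(_ < _) _; suff -> : E y = 0 by rewrite mulr0.
  rewrite /y; elim/big_ind: _ => [|u v hu hv|i _]; first exact: der1.
    by rewrite EM hu hv mulr0 mul0r addr0.
  by rewrite derXn Ex ?mulr0 //; exact: ltn_ord i.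
move=> z; have [p [r [r0 ->]]] := fracK z.
by rewrite EM derV // !Eev oppr0 !mul0r mulr0 addr0.
Qed.

End Derivation.

Variable D : K -> K.
Hypothesis hD : is_derivation iota D.
Hypothesis D_ev : forall p, D (ev p) = tder p.

Lemma D_x i : (i <= k)%N -> D (x i) = tangent i.
Proof. by move=> ik; rewrite -evX // D_ev tderU inordK. Qed.

(** The derivations of K over F form a line, since the combination of E and D that kills x_0
    vanishes. [ord_d] involves an unspecified derivation, and this compares it with D. *)
Lemma der_prop E z : is_derivation iota E -> E z * tangent 0 = E (x 0) * D z.
Proof.
move=> hE; have [ED EM EC] := hE; have [DD DM DC] := hD.
pose G z := E z * tangent 0 - E (x 0) * D z.
have hG : is_derivation iota G.
  by split=> [u v|u v|c]; rewrite /G ?ED ?DD ?EM ?DM ?EC ?DC; ring.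
apply/eqP; rewrite -subr_eq0; apply/eqP; apply: (der_eq0 hG).
by rewrite /G D_x // subrr.
Qed.

(** * The affine coordinate ring and the centres of affine points *)

Definition inO (z : K) := exists p, z = ev p.

Lemma inOD y z : inO y -> inO z -> inO (y + z).
Proof. by move=> [p ->] [q ->]; exists (p + q); rewrite rmorphD. Qed.
Lemma inON y : inO y -> inO (- y).
Proof. by move=> [p ->]; exists (- p); rewrite rmorphN. Qed.
Lemma inOM y z : inO y -> inO z -> inO (y * z).
Proof. by move=> [p ->] [q ->]; exists (p * q); rewrite rmorphM. Qed.
Lemma inOC c : inO (iota c).
Proof. by exists c%:MP; rewrite mmapC. Qed.
Lemma inOx i : (i <= k)%N -> inO (x i).
Proof. by move=> ik; exists 'X_(inord i); rewrite evX. Qed.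
Lemma inO1 : inO 1. Proof. by rewrite -(rmorph1 iota); exact: inOC. Qed.
Lemma inO0 : inO 0. Proof. by rewrite -(rmorph0 iota); exact: inOC. Qed.
Lemma inOX y n : inO y -> inO (y ^+ n).
Proof. by move=> [p ->]; exists (p ^+ n); rewrite rmorphXn. Qed.
Lemma inO_horner (p : {poly F}) y : inO y -> inO (map_poly iota p).[y].
Proof.
move=> hy; rewrite horner_coef; elim/big_ind: _ => [||i _]; first exact: inO0.
  exact: inOD.
by rewrite coef_map; apply: inOM; [exact: inOC|exact: inOX].
Qed.
Lemma inO_tangent i : (i <= k)%N -> inO (tangent i).
Proof.
move=> ik; apply: inOM; [elim/big_ind: _ => [||l _]|
  rewrite big_nat; elim/big_ind: _ => [||l /andP[_ lk]]];
  try exact: inO1; try exact: inOM.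
  by apply/inO_horner/inOx/ltnW/(leq_trans (ltn_ord l)).
apply: inOM; last exact/inOX/inOx.
by rewrite -(rmorph_nat iota); exact: inOC.
Qed.

Lemma inO_D y : inO y -> inO (D y).
Proof.
move=> [p ->]; rewrite D_ev /tder; elim/big_ind: _ => [||l _]; first exact: inO0.
  exact: inOD.
apply: inOM; first by eexists.
by apply: inO_tangent; exact: ltn_ord l.
Qed.

Lemma integral_coord y : inO y ->
  integralOver (horner_eval (x 0) \o map_poly iota) y.
Proof.
set phi := (_ \o _).
have iC c : integralOver phi (iota c).
  have -> : iota c = phi c%:P by rewrite /phi /= map_polyC /horner_eval hornerC.
  exact: integral_id.
have ix i : (i <= k)%N -> integralOver phi (x i).
  elim: i => [_|i IH ik].
    have -> : x 0 = phi 'X by rewrite /phi /= map_polyX /horner_eval hornerX.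
    exact: integral_id.
  have fi : integralOver phi (map_poly iota (f i)).[x i].
    apply: integral_horner (IH (ltnW ik)); apply/integral_poly => l.
    by rewrite coef_map; exact: iC.
  apply: (@integral_root_monic _ _ _ _ ('X^(a i) - (map_poly iota (f i)).[x i]%:P)).
  - by rewrite monicXnsubC ?a_gt0.
  - by rewrite /root !hornerE tower // subrr.
  apply/integral_poly => l; rewrite coefB coefXn coefC; apply: integral_sub.
    exact: integral_nat.
  by case: eqP => _ //; exact: integral0.
move=> [p ->]; rewrite /mmap; elim/big_ind: _ => [||m _]; first exact: integral0.
  exact: integral_add.
apply: integral_mul; first exact: iC.
rewrite /mmap1; elim/big_ind: _ => [||i _]; [exact: integral1|exact: integral_mul|].
elim: (m i) => [|n IH]; first exact: integral1.
by rewrite exprS; apply: integral_mul => //; apply: ix; exact: ltn_ord i.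
Qed.

(* The constant term of an equation of integral dependence of y over F[x_0] is a
   multiple of y. *)
Lemma divides_poly_x0 y : inO y -> y != 0 ->
  exists (q : {poly F}) (s : K), [/\ q != 0, inO s & y * s = (map_poly iota q).[x 0]].
Proof.
move=> Oy y0; have [P0 mP0 rP0] := integral_coord Oy.
move: (monic_neq0 mP0) rP0 => {mP0}; rewrite /root.
elim/poly_ind: P0 => [|Q c IH]; first by rewrite eqxx.
rewrite rmorphD rmorphM /= map_polyX map_polyC /= !hornerE.
have [->|c0] := eqVneq c 0.
  have -> : horner_eval (x 0) (map_poly iota 0) = 0 by rewrite /horner_eval rmorph0 horner0.
  rewrite polyC0 !addr0 [in X in _ -> X]mulf_eq0 (negPf y0) orbF mulf_eq0 negb_or.
  by move=> /andP[Q0 _]; exact: IH.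
move=> _; rewrite addrC addr_eq0 /horner_eval => /eqP h.
exists c, (- (map_poly (horner_eval (x 0) \o map_poly iota) Q).[y]); split=> //.
  apply: inON; rewrite horner_coef; elim/big_ind: _ => [||i _]; first exact: inO0.
    exact: inOD.
  apply: inOM; last exact: inOX.
  by rewrite coef_map /= /horner_eval; apply/inO_horner/inOx.
by rewrite h mulrN mulrC.
Qed.

Lemma inO_frac z : exists y w, [/\ inO y, inO w, w != 0 & z = y / w].
Proof.
by have [p [r [r0 ->]]] := fracK z; exists (ev p), (ev r); split=> //; eexists.
Qed.

Lemma vge_inO (P : curve_point iota) y : vge P 0 (x 0) -> inO y -> vge P 0 y.
Proof.
move=> hP [p ->]; rewrite /mmap; apply: vge_sum => m _; apply: vgeMl; first exact: vge_const.
by rewrite /mmap1; apply: vge_prod => i _; apply/vgeX/affine_coord => //; exact: ltn_ord i.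
Qed.

Lemma poly_splits (p : {poly F}) : exists s : seq F,
  p = lead_coef p *: \prod_(r <- s) ('X - r%:P).
Proof. by have [s es] := closed_field_poly_normal p; exists s. Qed.

Lemma horner_prodXsubC (s : seq F) z :
  (map_poly iota (\prod_(r <- s) ('X - r%:P))).[z] = \prod_(r <- s) (z - iota r).
Proof.
rewrite rmorph_prod horner_prod; apply: eq_bigr => r _.
by rewrite rmorphB /= map_polyX map_polyC !hornerE.
Qed.

Lemma vge1_prod (P : curve_point iota) (s : seq F) z :
  vge P 0 z -> vge P 1 (\prod_(r <- s) (z - iota r)) ->
  exists2 r, r \in s & vge P 1 (z - iota r).
Proof.
move=> hz; elim: s => [|r s IH].
  by rewrite big_nil vgeE ?oner_neq0 // val1.
rewrite big_cons; have [h|h] := pselect (vge P 1 (z - iota r)).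
  by move=> _; exists r; rewrite ?mem_head.
have z0 : z - iota r != 0 by apply/eqP => e; apply: h; left.
have Pz : P (z - iota r) = 0.
  have : vge P 0 (z - iota r) by apply: vgeB => //; exact: vge_const.
  rewrite vgeE // => h1; apply/eqP; rewrite eq_le h1 andbT leNgt; apply/negP => h2.
  by apply: h; right; lia.
have [w0 _|w0] := eqVneq (\prod_(r <- s) (z - iota r)) 0.
  by case: IH => [|r' r's h']; [left|exists r' => //; rewrite inE r's orbT].
rewrite vgeE ?mulf_neq0 // ord_mul // Pz add0r => h1.
by case: IH => [|r' r's h']; [right|exists r' => //; rewrite inE r's orbT].
Qed.

(** Otherwise every x_0 - c is a unit at P, hence so is every nonzero polynomial in x_0, then every
    nonzero element of O, being a divisor in O of such a polynomial, and all of K would have order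
    0. *)
Lemma centre0 (P : curve_point iota) : vge P 0 (x 0) -> exists c, vge P 1 (x 0 - iota c).
Proof.
move=> hP; apply: contrapT => hc.
have hq (q : {poly F}) : q != 0 -> (map_poly iota q).[x 0] != 0 /\ P (map_poly iota q).[x 0] = 0.
  move=> q0; have [s es] := poly_splits q.
  have : ~ vge P 1 (map_poly iota q).[x 0].
    rewrite es linearZ /= hornerZ => h.
    have : vge P 1 (\prod_(r <- s) (x 0 - iota r)).
      have l0 : iota (lead_coef q) != 0 by rewrite fmorph_eq0 lead_coef_eq0.
      rewrite -horner_prodXsubC -[X in vge _ _ X](mulKf l0).
      by apply: vgeMl h; rewrite -fmorphV; exact: vge_const.
    by case/(vge1_prod hP) => r _ hr; apply: hc; exists r.
  move=> h; have h0 : (map_poly iota q).[x 0] != 0 by apply/eqP => e; apply: h; left.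
  split=> //; have /(vgeE _ _ h0) h1 := vge_horner q hP.
  by apply/eqP; rewrite eq_le h1 andbT leNgt; apply/negP => h2; apply: h; right; lia.
have hO y : inO y -> y != 0 -> P y = 0.
  move=> Oy y0; have [q [s [q0 Os e]]] := divides_poly_x0 Oy y0.
  have [h1 h2] := hq _ q0; move: h1 h2; rewrite -e mulf_eq0 negb_or => /andP[_ s0].
  rewrite ord_mul //.
  have /(vgeE _ _ y0) := vge_inO hP Oy; have /(vgeE _ _ s0) := vge_inO hP Os.
  by lia.
have [t [t0]] := ord_unif P; have [y [w [Oy Ow w0 e]]] := inO_frac t.
have y0 : y != 0 by apply: contraNneq t0 => y0; rewrite e y0 mul0r.
by rewrite e ord_mul ?invr_eq0 // valV // !hO.
Qed.

Lemma poly_taylor1 (p : {poly F}) c : exists2 q : {poly F},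
  q.[c] = p^`().[c] & forall z : K,
  (map_poly iota p).[z] - iota p.[c] = (z - iota c) * (map_poly iota q).[z].
Proof.
have /factor_theorem[q e] : root (p - p.[c]%:P) c by rewrite /root !hornerE subrr.
exists q.
  have := congr1 (fun u => u^`().[c]) e; rewrite derivB derivC subr0 derivM derivXsubC.
  by rewrite mulr1 !hornerE subrr mulr0 add0r.
move=> z; have := congr1 (fun u => (map_poly iota u).[z]) e.
rewrite rmorphB rmorphM /= rmorphB /= map_polyX !map_polyC /= !hornerE => ->.
by rewrite mulrC.
Qed.

Definition on_tower (v : nat -> F) := forall i, (i < k)%N -> v i.+1 ^+ a i = (f i).[v i].

(** The coordinates are found one at a time: x_{n+1}^{a_n} is congruent to u = f_n(v_n), so for some
    root r of X^{a_n} - u the factor x_{n+1} - r lies in the maximal ideal. *)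
Lemma centre (P : curve_point iota) : vge P 0 (x 0) -> exists2 v, on_tower v &
  forall i, (i <= k)%N -> vge P 1 (x i - iota (v i)).
Proof.
move=> hP; suff H n : (n <= k)%N -> exists2 v,
    (forall i, (i < n)%N -> v i.+1 ^+ a i = (f i).[v i]) &
    forall i, (i <= n)%N -> vge P 1 (x i - iota (v i)) by apply: H.
elim: n => [_|n IH nk].
  have [c hc] := centre0 hP; exists (fun=> c) => // i; rewrite leqn0 => /eqP->//.
have [v tv hv] := IH (ltnW nk); have xn := affine_coord hP.
set u := (f n).[v n]; have [s es] := poly_splits ('X^(a n) - u%:P).
have := monicXnsubC u (a_gt0 nk); rewrite monicE => /eqP lc.
rewrite lc scale1r in es.
have [|r rs hr] := @vge1_prod P s (x n.+1) (xn _ nk).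
  rewrite -horner_prodXsubC -es rmorphB /= map_polyXn map_polyC !hornerE tower //.
  have [q _ ->] := poly_taylor1 (f n) (v n).
  by apply: vgeMr; [exact: hv|apply/vge_horner/xn/ltnW].
exists (fun i => if i == n.+1 then r else v i).
  move=> i; rewrite ltnS leq_eqVlt => /orP[/eqP->|lin].
    rewrite eqxx ltn_eqF //; apply/eqP; rewrite -subr_eq0 -/u.
    have : root ('X^(a n) - u%:P) r by rewrite es root_prod_XsubC.
    by rewrite /root !hornerE.
  by rewrite !ltn_eqF ?tv // ltnS ltnW.
move=> i; rewrite leq_eqVlt => /orP[/eqP->|lin]; first by rewrite eqxx.
by rewrite ltn_eqF //; apply: hv.
Qed.

Local Notation evp v p := (meval (fun i : 'I_k.+1 => v (i : nat)) p).

(** Left abstract because it serves three times: in the local ring at v, in the valuation ring of a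
    point centred at v, and modulo an ideal of O. *)
Lemma ev_congr (I0 I1 : K -> Prop) v :
  (forall y z, I0 y -> I0 z -> I0 (y + z)) ->
  (forall y z, I0 y -> I0 z -> I0 (y * z)) ->
  (forall c, I0 (iota c)) -> (forall i, (i <= k)%N -> I0 (x i)) ->
  I1 0 -> (forall y z, I1 y -> I1 z -> I1 (y + z)) ->
  (forall y z, I1 y -> I0 z -> I1 (y * z)) ->
  (forall i, (i <= k)%N -> I1 (x i - iota (v i))) ->
  forall p, I1 (ev p - iota (evp v p)).
Proof.
move=> I0D I0M I0C I0x I10 I1D I1M I1x p.
pose rel z c := I0 z /\ I1 (z - iota c).
have relC c : rel (iota c) c by split=> //; rewrite subrr.
have relD y c z d : rel y c -> rel z d -> rel (y + z) (c + d).
  move=> [h1 h2] [h3 h4]; split; first exact: I0D.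
  by rewrite rmorphD opprD addrACA; exact: I1D.
have relM y c z d : rel y c -> rel z d -> rel (y * z) (c * d).
  move=> [h1 h2] [h3 h4]; split; first exact: I0M.
  have -> : y * z - iota (c * d) = (y - iota c) * z + (z - iota d) * iota c.
    by rewrite rmorphM /=; ring.
  by apply: I1D; apply: I1M.
suff [] : rel (ev p) (evp v p) by [].
rewrite mevalE /mmap; elim/big_ind2: _ => [|y c z d|m _]; last 1 first.
- apply: (relM); first exact: relC.
  rewrite /mmap1; elim/big_ind2: _ => [|y c z d|i _]; last 1 first.
  + elim: (m i) => [|n IH]; first by have := relC 1; rewrite rmorph1.
    rewrite !exprS; apply: (relM) => //; split; first by apply: I0x; exact: ltn_ord i.
    by apply: I1x; exact: ltn_ord i.
  + by have := relC 1; rewrite rmorph1.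
  exact: relM.
- by have := relC 0; rewrite rmorph0.
exact: relD.
Qed.

Hypothesis ev_point : forall p, ev p = 0 -> forall v, on_tower v -> evp v p = 0.

(** * The local ring at a smooth affine point *)

Section LocalRing.
Variables (v : nat -> F) (j : nat).
Hypothesis tv : on_tower v.
Hypothesis jk : (j <= k)%N.
Hypothesis sm1 : forall i, (i < j)%N -> (f i)^`().[v i] != 0.
Hypothesis sm2 : forall i, (j <= i < k)%N -> (a i)%:R * v i.+1 ^+ (a i).-1 != 0.

Definition inOv z := exists p r, evp v r != 0 /\ z = ev p / ev r.
Definition Uv z := exists p r, [/\ evp v p != 0, evp v r != 0 & z = ev p / ev r].
(** By [sm1] and [sm2] the minor [tangent j], which is the derivative of this element along D, is a
    unit at v. *)
Definition lpar := x j - iota (v j).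
Local Notation t := lpar.
Definition tOv z := exists2 w, inOv w & z = t * w.

Lemma evp_neq0 r : evp v r != 0 -> ev r != 0.
Proof. by apply: contraNneq => /ev_point/(_ v tv) ->. Qed.

Lemma Ov_inO z : inO z -> inOv z.
Proof. by move=> [p ->]; exists p, 1; rewrite !rmorph1 oner_neq0 divr1. Qed.

Lemma OvD y z : inOv y -> inOv z -> inOv (y + z).
Proof.
move=> [p [r [r0 ->]]] [q [s [s0 ->]]]; exists (p * s + q * r), (r * s).
rewrite rmorphM mulf_neq0 // rmorphD !rmorphM /=; split=> //.
by field; rewrite !evp_neq0.
Qed.

Lemma OvM y z : inOv y -> inOv z -> inOv (y * z).
Proof.
move=> [p [r [r0 ->]]] [q [s [s0 ->]]]; exists (p * q), (r * s).
rewrite rmorphM mulf_neq0 // !rmorphM /=; split=> //.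
by field; rewrite !evp_neq0.
Qed.

Lemma OvC c : inOv (iota c). Proof. exact/Ov_inO/inOC. Qed.
Lemma OvX y n : inOv y -> inOv (y ^+ n).
Proof.
move=> hy; elim: n => [|n IH]; first by rewrite expr0 -(rmorph1 iota); exact: OvC.
by rewrite exprS; exact: OvM.
Qed.

Lemma Uv_Ov z : Uv z -> inOv z.
Proof. by move=> [p [r [_ r0 ->]]]; exists p, r. Qed.

Lemma UvM y z : Uv y -> Uv z -> Uv (y * z).
Proof.
move=> [p [r [p0 r0 ->]]] [q [s [q0 s0 ->]]]; exists (p * q), (r * s).
rewrite !rmorphM !mulf_neq0 //; split=> //=.
by field; rewrite !evp_neq0.
Qed.

Lemma UvV y : Uv y -> Uv y^-1.
Proof. by move=> [p [r [p0 r0 ->]]]; exists r, p; rewrite invf_div. Qed.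

Lemma Uv_neq0 y : Uv y -> y != 0.
Proof. by move=> [p [r [p0 r0 ->]]]; rewrite mulf_neq0 ?invr_eq0 ?evp_neq0. Qed.

Lemma Uv_ev p : evp v p != 0 -> Uv (ev p).
Proof. by move=> p0; exists p, 1; rewrite !rmorph1 oner_neq0 divr1. Qed.

Lemma Uv1 : Uv 1.
Proof. by have := @Uv_ev 1; rewrite !rmorph1; apply; exact: oner_neq0. Qed.

Lemma UvX y n : Uv y -> Uv (y ^+ n).
Proof. by move=> hy; elim: n => [|n IH]; rewrite ?exprS; [exact: Uv1|exact: UvM]. Qed.

Lemma evpX i : (i <= k)%N -> evp v 'X_(inord i) = v i.
Proof. by move=> ik; rewrite mevalXU inordK. Qed.

Lemma Uv_horner (q : {poly F}) i : (i <= k)%N -> q.[v i] != 0 -> Uv (map_poly iota q).[x i].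
Proof.
move=> ik; pose p : {mpoly F[k.+1]} := \sum_(l < size q) q`_l *: 'X_(inord i) ^+ l.
have -> : q.[v i] = evp v p.
  rewrite horner_coef /p rmorph_sum; apply: eq_bigr => l _ /=.
  by rewrite mevalZ rmorphXn /= evpX.
have -> : (map_poly iota q).[x i] = ev p.
  rewrite horner_coef size_map_poly /p rmorph_sum; apply: eq_bigr => l _ /=.
  by rewrite coef_map mmapZ rmorphXn /= evX.
exact: Uv_ev.
Qed.

Lemma tOv_mul y z : tOv y -> inOv z -> tOv (y * z).
Proof. by move=> [w hw ->] hz; exists (w * z); [exact: OvM|rewrite mulrA]. Qed.

Lemma tOv_add y z : tOv y -> tOv z -> tOv (y + z).
Proof. by move=> [w hw ->] [w' hw' ->]; exists (w + w'); [exact: OvD|rewrite mulrDr]. Qed.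

(** Clearing denominators gives a relation in O; evaluated at v, it equates a nonzero number with
    0. *)
Lemma Uv_not_tOv u : Uv u -> ~ tOv u.
Proof.
move=> [p [r [p0 r0 ->]]] [_ [q [s [s0 ->]]]].
have tE : t = ev ('X_(inord j) - (v j)%:MP) by rewrite rmorphB /= evX // mmapC.
rewrite tE => e.
have /ev_point/(_ v tv) : ev (p * s - r * ('X_(inord j) - (v j)%:MP) * q) = 0.
  rewrite rmorphB !rmorphM /=; apply/eqP; rewrite subr_eq0; apply/eqP.
  move: e => /(congr1 (fun y => y * ev r * ev s)).
  rewrite divfK ?evp_neq0 // => ->; field; exact: evp_neq0.
rewrite rmorphB !rmorphM /= rmorphB /= evpX // mevalC subrr mulr0 mul0r subr0.
by move/eqP; rewrite mulf_eq0 (negPf p0) (negPf s0).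
Qed.

(** The two factorisations of one difference link x_i - v_i with x_{i+1} - v_{i+1}; one can pass to
    the side whose cofactor is a unit, that is, whose derivative does not vanish at v. *)
Lemma tower_taylor i : (i < k)%N -> exists q1 q2 : {poly F},
  [/\ q1.[v i.+1] = (a i)%:R * v i.+1 ^+ (a i).-1, q2.[v i] = (f i)^`().[v i],
   x i.+1 ^+ a i - iota (v i.+1 ^+ a i) =
      (x i.+1 - iota (v i.+1)) * (map_poly iota q1).[x i.+1] &
   x i.+1 ^+ a i - iota (v i.+1 ^+ a i) =
      (x i - iota (v i)) * (map_poly iota q2).[x i]].
Proof.
move=> ik; have [q1 h1 h2] := poly_taylor1 'X^(a i) (v i.+1).
have [q2 h3 h4] := poly_taylor1 (f i) (v i).
exists q1, q2; split=> //.
- by rewrite h1 derivXn hornerMn hornerXn mulr_natl.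
- by rewrite -h2 map_polyXn !hornerXn.
by rewrite -h4 tv // tower.
Qed.

Lemma lpar_up i : (j <= i <= k)%N -> tOv (x i - iota (v i)).
Proof.
move=> /andP[]; elim: i => [|i IH].
  rewrite leqn0 => /eqP j0 _; exists 1; first exact: Uv_Ov Uv1.
  by rewrite mulr1 /t j0.
rewrite leq_eqVlt => /orP[/eqP <- _|ji ik].
  by exists 1; [exact: Uv_Ov Uv1|rewrite mulr1].
have [q1 [q2 [h1 h2 h3 h4]]] := tower_taylor ik.
have u1 : Uv (map_poly iota q1).[x i.+1] by apply: Uv_horner; rewrite // h1 sm2 // ik andbT.
have -> : x i.+1 - iota (v i.+1) =
   (x i - iota (v i)) * ((map_poly iota q2).[x i] / (map_poly iota q1).[x i.+1]).
  by rewrite mulrA -h4 h3 mulfK // Uv_neq0.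
apply: tOv_mul; first exact/IH/ltnW.
apply: OvM; last exact/Uv_Ov/UvV.
by apply/Ov_inO/inO_horner/inOx/ltnW.
Qed.

(** Below j the cofactor on the side of x_i is a unit by [sm1]. The exponent is a ramification
    index: it is multiplied by a_n where v_{n+1} = 0 and unchanged elsewhere. An exact power of t is
    needed at x_0, to factor polynomials in x_0. *)
Lemma lpar_down i : (i <= j)%N ->
  exists e u, Uv u /\ x (j - i) - iota (v (j - i)) = t ^+ e.+1 * u.
Proof.
elim: i => [_|i IH ij].
  by exists 0, 1; rewrite subn0 expr1 mulr1; split=> //; exact: Uv1.
have [e [u [Uu eu]]] := IH (ltnW ij).
have nE : (j - i = (j - i.+1).+1)%N by lia.
set n := (j - i.+1)%N in nE *; rewrite nE in eu.
have nj : (n < j)%N by rewrite /n; lia.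
have nk := leq_trans nj jk.
have [q1 [q2 [h1 h2 h3 h4]]] := tower_taylor nk.
have u2 : Uv (map_poly iota q2).[x n] by apply: Uv_horner; [exact: ltnW|rewrite h2 sm1].
have an := a_gt0 nk.
have [v0|v0] := eqVneq (v n.+1) 0.
  exists (e.+1 * a n).-1, (u ^+ a n / (map_poly iota q2).[x n]).
  split; first by apply: UvM; [exact: UvX|exact: UvV].
  rewrite prednK ?muln_gt0 // mulrA exprM -exprMn -eu v0 rmorph0 subr0.
  apply: (mulIf (Uv_neq0 u2)); rewrite divfK ?Uv_neq0 // -h4 v0 expr0n.
  by rewrite eqn0Ngt an rmorph0 subr0.
have u1 : Uv (map_poly iota q1).[x n.+1].
  by apply: Uv_horner => //; rewrite h1 mulf_neq0 ?expf_neq0 // pnatr_eq0 -lt0n.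
exists e, (u * (map_poly iota q1).[x n.+1] / (map_poly iota q2).[x n]).
split; first by apply: UvM; [exact: UvM|exact: UvV].
apply: (mulIf (Uv_neq0 u2)); rewrite -h4 h3 eu !mulrA divfK ?Uv_neq0 //.
Qed.

Lemma lpar0 : exists e u, Uv u /\ x 0 - iota (v 0) = t ^+ e.+1 * u.
Proof. by have := lpar_down (leqnn j); rewrite subnn. Qed.

Lemma lpar_coord i : (i <= k)%N -> tOv (x i - iota (v i)).
Proof.
move=> ik; case: (leqP j i) => ij; first by apply: lpar_up; rewrite ij.
have [e [u [Uu]]] := lpar_down (leq_subr i j); rewrite subKn 1?ltnW // => ->.
exists (t ^+ e * u); last by rewrite exprS mulrA.
apply: OvM; last exact: Uv_Ov.
apply: OvX; apply: OvD; first exact/Ov_inO/inOx.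
by rewrite -rmorphN; exact: OvC.
Qed.

Lemma ev_tOv p : tOv (ev p - iota (evp v p)).
Proof.
apply: (@ev_congr inOv) => //; try exact: OvD; try exact: OvM; try exact: OvC.
- by move=> i ik; exact/Ov_inO/inOx.
- by exists 0; rewrite ?mulr0 // -(rmorph0 iota); exact: OvC.
- exact: tOv_add.
- exact: tOv_mul.
exact: lpar_coord.
Qed.

Lemma Ov_cases z : inOv z -> Uv z \/ tOv z.
Proof.
move=> [p [r [r0 ->]]]; have [p0|p0] := eqVneq (evp v p) 0; last by left; exists p, r.
right; apply: tOv_mul; last by apply/Uv_Ov/UvV/Uv_ev.
by have := ev_tOv p; rewrite p0 rmorph0 subr0.
Qed.

Lemma x0_nonconst c : x 0 - iota c != 0.
Proof.
have [x0 xn] := inf_coord0 Pinf_inf; apply/eqP => /eqP; rewrite subr_eq0 => /eqP e.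
by have := vge_const Pinf c; rewrite -e vgeE // leNgt xn.
Qed.

Lemma lpar_neq0 : t != 0.
Proof.
have [e [u [_ h]]] := lpar0; have := x0_nonconst (v 0); rewrite h mulf_eq0 negb_or.
by rewrite expf_eq0 => /andP[].
Qed.

(** A divisor of a power of t is a power of t up to a unit. The induction on N bounds how often t
    can be divided out of z. *)
Lemma Ov_factor N z w u : inOv z -> inOv w -> Uv u -> z * w = t ^+ N * u ->
  exists n u', Uv u' /\ z = t ^+ n * u'.
Proof.
elim: N z => [|N IH] z hz hw Uu e.
  exists 0, z; rewrite expr0 mul1r; split=> //.
  case: (Ov_cases hz) => // hz'; case: (@Uv_not_tOv u) => //.
  by move: e; rewrite expr0 mul1r => <-; exact: tOv_mul.
case: (Ov_cases hz) => [Uz|[z' hz' ez]]; first by exists 0, z; rewrite expr0 mul1r.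
have [|n [u' [Uu' e']]] := IH z' hz' hw Uu.
  by apply: (mulfI lpar_neq0); rewrite mulrA -ez e exprS mulrA.
by exists n.+1, u'; rewrite ez e' exprS mulrA.
Qed.

(** y divides a nonzero polynomial in x_0, and splitting off its zeros at v_0 leaves a power of x_0
    - v_0, hence of t, times a unit. *)
Lemma inO_factor y : inO y -> y != 0 -> exists n u, Uv u /\ y = t ^+ n * u.
Proof.
move=> Oy y0; have [q [s [q0 Os e]]] := divides_poly_x0 Oy y0.
have [m [q' nr eq]] := multiplicity_XsubC q (v 0).
have [e0 [u [Uu ue]]] := lpar0.
have r' : q'.[v 0] != 0 by move: nr; rewrite q0 /root.
apply: (@Ov_factor (e0.+1 * m) y s (u ^+ m * (map_poly iota q').[x 0])).
- exact: Ov_inO.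
- exact: Ov_inO.
- by apply: UvM; [exact: UvX|exact: Uv_horner].
rewrite e eq rmorphM rmorphXn rmorphB /= map_polyX map_polyC hornerM horner_exp !hornerE.
by rewrite ue exprMn -exprM mulrC.
Qed.

Lemma factor z : z != 0 -> exists n m u, Uv u /\ z * t ^+ m = t ^+ n * u.
Proof.
move=> z0; have [y [w [Oy Ow w0 e]]] := inO_frac z.
have y0 : y != 0 by apply: contraNneq z0 => y0; rewrite e y0 mul0r.
have [n [u [Uu eu]]] := inO_factor Oy y0.
have [m [u' [Uu' eu']]] := inO_factor Ow w0.
exists n, m, (u / u'); split; first by apply: UvM => //; exact: UvV.
rewrite e eu eu'; field; rewrite Uv_neq0 // expf_neq0 ?lpar_neq0 //.
Qed.

Lemma factor_le n m u w : Uv u -> inOv w -> t ^+ n * u = t ^+ m * w -> (m <= n)%N.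
Proof.
move=> Uu hw e; rewrite leqNgt; apply/negP => nm; case: (@Uv_not_tOv u) => //.
exists (t ^+ (m - n).-1 * w).
  apply: OvM => //; apply: OvX; apply: OvD; first exact/Ov_inO/inOx.
  by rewrite -rmorphN; exact: OvC.
apply: (mulfI (expf_neq0 n lpar_neq0)); rewrite e mulrA -exprS mulrA -exprD.
by congr (t ^+ _ * _); lia.
Qed.

Lemma factor_inj n m u w : Uv u -> Uv w -> t ^+ n * u = t ^+ m * w -> n = m.
Proof.
move=> Uu Uw e; apply/eqP; rewrite eqn_leq.
by rewrite (factor_le Uu (Uv_Ov Uw) e) (factor_le Uw (Uv_Ov Uu) (esym e)).
Qed.

(** The pair n, m avoids negative powers of t; the default value is taken only at z = 0. *)
Definition ordv (z : K) : int := xget 0 [set d | exists n m u,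
  [/\ Uv u, z * t ^+ m = t ^+ n * u & d = n%:Z - m%:Z]]%classic.

Lemma ordvE z n m u : Uv u -> z * t ^+ m = t ^+ n * u -> ordv z = n%:Z - m%:Z.
Proof.
move=> Uu e; rewrite /ordv.
case: xgetP => [d _ [n' [m' [u' [Uu' e' ->]]]]|/(_ (n%:Z - m%:Z))]; last first.
  by case; exists n, m, u.
have : t ^+ (n + m') * u = t ^+ (n' + m) * u'.
  by rewrite !exprD [LHS]mulrAC -e [RHS]mulrAC -e'; ring.
by move/(factor_inj Uu Uu'); lia.
Qed.

Lemma ordv_point : exists Pv : curve_point iota,
  [/\ vge Pv 0 (x 0) & forall z, vge Pv 0 z -> inOv z].
Proof.
have h1 c : c != 0 -> ordv (iota c) = 0.
  move=> c0; rewrite (@ordvE _ 0 0 (iota c)) ?expr0 ?mulr1 ?mul1r //.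
  by have := @Uv_ev c%:MP; rewrite mmapC mevalC; exact.
have h2 y z : y != 0 -> z != 0 -> ordv (y * z) = ordv y + ordv z.
  move=> /factor[n [m [u [Uu e]]]] /factor[n' [m' [u' [Uu' e']]]].
  rewrite (ordvE Uu e) (ordvE Uu' e') (@ordvE _ (n + n') (m + m') (u * u')).
  - lia.
  - exact: UvM.
  by rewrite !exprD mulrACA e e' mulrACA.
have h3 y z : y != 0 -> z != 0 -> y + z != 0 -> Num.min (ordv y) (ordv z) <= ordv (y + z).
  move=> /factor[n [m [u [Uu e]]]] /factor[n' [m' [u' [Uu' e']]]] /factor[n2 [m2 [u2 [Uu2 e2]]]].
  rewrite (ordvE Uu e) (ordvE Uu' e') (ordvE Uu2 e2).
  (* After multiplication by t^(m + m' + m2), both summands are divisible by t^N. *)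
  pose N := minn (n + m' + m2) (n' + m + m2).
  suff : (N <= n2 + m + m')%N by rewrite /N ge_min; lia.
  have tO n0 : inOv (t ^+ n0).
    apply: OvX; apply: OvD; first exact/Ov_inO/inOx.
    by rewrite -rmorphN; exact: OvC.
  apply: (@factor_le _ _ _ (t ^+ (n + m' + m2 - N) * u + t ^+ (n' + m + m2 - N) * u') Uu2).
    by apply: OvD; apply: OvM => //; exact: Uv_Ov.
  rewrite mulrDr !mulrA -!exprD !subnKC ?geq_minl ?geq_minr //.
  rewrite !exprD; transitivity ((y + z) * t ^+ m2 * (t ^+ m * t ^+ m')).
    by rewrite e2; ring.
  transitivity (y * t ^+ m * (t ^+ m' * t ^+ m2) + z * t ^+ m' * (t ^+ m * t ^+ m2)).
    by ring.
  by rewrite e e'; ring.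
have h4 : exists s, s != 0 /\ ordv s = 1.
  exists t; split; first exact: lpar_neq0.
  by rewrite (@ordvE _ 1 0 1) ?expr0 ?expr1 //; exact: Uv1.
exists (CurvePoint h1 h2 h3 h4).
have geO z : inOv z -> vge (CurvePoint h1 h2 h3 h4) 0 z.
  move=> hz; have [->|z0] := eqVneq z 0; first by left.
  right; rewrite /=; have [n [m [u [Uu e]]]] := factor z0.
  rewrite (ordvE Uu e) subr_ge0; rewrite mulrC in e.
  by have := factor_le Uu hz (esym e).
split; first exact/geO/Ov_inO/inOx.
move=> z; have [->|z0] := eqVneq z 0; first by move=> _; rewrite -(rmorph0 iota); exact: OvC.
rewrite vgeE //=; have [n [m [u [Uu e]]]] := factor z0.
rewrite (ordvE Uu e) subr_ge0 lez_nat => mn.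
have -> : z = t ^+ (n - m) * u.
  by apply: (mulIf (expf_neq0 m lpar_neq0)); rewrite e mulrAC -exprD subnK.
apply: OvM; last exact: Uv_Ov.
apply: OvX; apply: OvD; first exact/Ov_inO/inOx.
by rewrite -rmorphN; exact: OvC.
Qed.

Lemma D_Ov z : inOv z -> inOv (D z).
Proof.
move=> [p [r [r0 ->]]]; have [_ DM _] := hD.
rewrite DM (derV hD) ?evp_neq0 //.
have Ur : Uv (ev r)^-1 by apply/UvV/Uv_ev.
have Oe q : inO (ev q) by exists q.
apply: OvD.
  by apply: OvM; [exact/Ov_inO/inO_D|exact: Uv_Ov].
apply: OvM; first exact: Ov_inO.
apply: OvM; first by apply/Ov_inO/inON/inO_D.
by rewrite -exprVn; apply/OvX/Uv_Ov.
Qed.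

Lemma Uv_tangent : Uv (tangent j).
Proof.
apply: UvM; [elim/big_ind: _ => [||l _]|
  rewrite big_nat; elim/big_ind: _ => [||l /andP[jl lk]]];
  try exact: Uv1; try exact: UvM.
  apply: Uv_horner; first by apply/ltnW/(leq_trans (ltn_ord l)).
  exact/sm1/ltn_ord.
have := sm2 (introT andP (conj jl lk)).
have -> : (a l)%:R * x l.+1 ^+ (a l).-1 = (map_poly iota ((a l)%:R *: 'X^((a l).-1))).[x l.+1].
  by rewrite linearZ /= map_polyXn !hornerE rmorph_nat.
by move=> h; apply: Uv_horner => //; rewrite !hornerE.
Qed.

Section Centred.
Variable P : curve_point iota.
Hypothesis P0 : vge P 0 (x 0).
Hypothesis Pv : forall i, (i <= k)%N -> vge P 1 (x i - iota (v i)).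

Lemma val_Uv u : Uv u -> P u = 0.
Proof.
have evU p : evp v p != 0 -> P (ev p) = 0.
  move=> p0; rewrite -[ev p](subrK (iota (evp v p))) addrC.
  have i0 : iota (evp v p) != 0 by rewrite fmorph_eq0.
  have [|_ ->] := @val_dom _ _ _ P (iota (evp v p)) (ev p - iota (evp v p)) i0;
    last exact: ord_const.
  rewrite ord_const // add0r.
  apply: (@ev_congr (vge P 0)) => //.
  - exact: vgeD.
  - exact: vgeMr.
  - exact: vge_const.
  - exact: affine_coord.
  - exact: vge0.
  - exact: vgeD.
  by move=> y z; exact: vgeMr.
move=> [p [r [p0 r0 ->]]]; rewrite ord_mul ?invr_eq0 ?evp_neq0 // valV ?evp_neq0 //.
by rewrite !evU.
Qed.

Lemma vge_Ov z : inOv z -> vge P 0 z.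
Proof.
move=> [p [r [r0 ->]]]; apply: vgeMr; first by apply: vge_inO => //; exists p.
by right; rewrite val_Uv //; apply/UvV/Uv_ev.
Qed.

(** An element of order 1 is t^(n - m) times a unit, so (n - m) ord t = 1, and ord t is positive. *)
Lemma val_lpar : P t = 1.
Proof.
have [s [s0 s1]] := ord_unif P; have [n [m [u [Uu e]]]] := factor s0.
have t0 := lpar_neq0.
have := congr1 P e; rewrite !ord_mul ?expf_neq0 // ?Uv_neq0 // !valX // (val_Uv Uu) addr0 s1.
have /(vgeE _ _ t0) := Pv jk; rewrite -/t => h1 h2.
have h3 : (n%:Z - m%:Z) * P t = 1 by rewrite mulrBl -h2 addrK.
have : (0 < n%:Z - m%:Z) by rewrite -(@pmulr_lgt0 _ (P t)) ?h3 //; lia.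
by nia.
Qed.

(** With s = u t and u a unit, D s = u [tangent j] + (D u) t; the first term is a unit and the
    second lies in the maximal ideal. *)
Lemma val_D_unif s : s != 0 -> P s = 1 -> D s != 0 /\ P (D s) = 0.
Proof.
move=> s0 s1; have t0 := lpar_neq0; have [n [m [u [Uu e]]]] := factor s0.
have [_ DM DC] := hD; have [DD _ _] := hD.
have nm : n = m.+1.
  have := congr1 P e; rewrite !ord_mul ?expf_neq0 // ?Uv_neq0 // !valX //.
  by rewrite (val_Uv Uu) val_lpar s1; lia.
have es : s = u * t.
  by apply: (mulIf (expf_neq0 m t0)); rewrite e nm exprS; ring.
have Dt : D t = tangent j by rewrite /t DD -rmorphN DC D_x // addr0.
rewrite es DM Dt addrC.
have Um : Uv (u * tangent j) by apply: UvM => //; exact: Uv_tangent.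
have [] := @val_dom _ _ _ P (u * tangent j) (D u * t) (Uv_neq0 Um).
  rewrite val_Uv // add0r; apply: vgeMl; last by right; rewrite val_lpar.
  by apply/vge_Ov/D_Ov/Uv_Ov.
by move=> -> ->; rewrite val_Uv.
Qed.

Lemma ord_d_affine : ord_d (x 0) P = P (tangent 0).
Proof.
(* Whatever parameter s and derivation E are selected by [xget], [der_prop] gives the same order;
   the pair s, D / D s below shows that the default value is not taken. *)
have key s E : s != 0 -> P s = 1 -> is_derivation iota E -> E s = 1 -> P (E (x 0)) = P (tangent 0).
  move=> s0 s1 hE Es; have [h1 h2] := val_D_unif s0 s1.
  have := der_prop s hE; rewrite Es mul1r => e.
  have E0 : E (x 0) != 0 by apply: contraNneq tangent0_neq0 => h; rewrite e h mul0r.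
  by rewrite e ord_mul // h2 addr0.
rewrite /ord_d; case: xgetP => [n _ [s [E [s0 s1 hE Es <-]]]|h]; first exact: key Es.
have [s [s0 s1]] := ord_unif P; have [h1 h2] := val_D_unif s0 s1.
have hE : is_derivation iota (fun z => D z / D s).
  by have [DD DM DC] := hD; split=> [y z|y z|c]; rewrite ?DD ?DM ?DC; field.
case: (h (P (D (x 0) / D s))); exists s, (fun z => D z / D s); split=> //.
by rewrite divff.
Qed.

End Centred.
End LocalRing.

Hypothesis smooth : forall v, on_tower v -> exists j, [/\ (j <= k)%N,
  forall i, (i < j)%N -> (f i)^`().[v i] != 0 &
  forall i, (j <= i < k)%N -> (a i)%:R * v i.+1 ^+ (a i).-1 != 0].

Lemma affine_ord_d (P : curve_point iota) : vge P 0 (x 0) -> ord_d (x 0) P = P (tangent 0).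
Proof.
move=> hP; have [v tv hv] := centre hP; have [j [jk sm1 sm2]] := smooth tv.
exact: (ord_d_affine tv jk sm1 sm2 hP hv).
Qed.

(** * Functions regular on the affine curve *)

Definition ideal (I : K -> Prop) := [/\ forall y, I y -> inO y, I 0,
  forall y z, I y -> I z -> I (y + z) & forall y z, I y -> inO z -> I (y * z)].

Definition adj (I : K -> Prop) (w y : K) := exists2 s, inO s & I (y - w * s).

Lemma adj_ideal I w : ideal I -> inO w -> ideal (adj I w).
Proof.
move=> [IO I0 ID IM] Ow; split.
- move=> y [s Os /IO h]; rewrite -[y](subrK (w * s)).
  by apply: inOD => //; exact: inOM.
- by exists 0; [exact: inO0|rewrite mulr0 subrr].
- move=> y z [s Os hs] [s' Os' hs']; exists (s + s'); first exact: inOD.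
  by rewrite mulrDr opprD addrACA; exact: ID.
move=> y z [s Os hs] Oz; exists (s * z); first exact: inOM.
by rewrite mulrA -mulrBl; exact: IM.
Qed.

Lemma adj_sub I w y : I y -> adj I w y.
Proof. by exists 0; [exact: inO0|rewrite mulr0 subr0]. Qed.

Lemma adj_mem I w : ideal I -> adj I w w.
Proof. by case=> _ I0 _ _; exists 1; [exact: inO1|rewrite mulr1 subrr]. Qed.

(** If 1 were in I + (y - r) for every r in s, multiplying these relations would put 1 in I plus the
    ideal of the product, which is I. *)
Lemma ideal_split I y (s : seq F) : ideal I -> inO y -> ~ I 1 ->
  I (\prod_(r <- s) (y - iota r)) ->
  exists2 r, r \in s & ~ adj I (y - iota r) 1.
Proof.
move=> hI Oy I1 Is; have [IO I0 ID IM] := hI; apply: contrapT => H; apply: I1.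
have Oyr r : inO (y - iota r) by apply: inOD => //; apply/inON/inOC.
suff [w Ow h] : adj I (\prod_(r <- s) (y - iota r)) 1.
  by rewrite -(subrK (\prod_(r <- s) (y - iota r) * w) 1); apply: (ID) => //; exact: IM.
have {H} : {in s, forall r, adj I (y - iota r) 1}.
  by move=> r rs; apply: contrapT => h; apply: H; exists r.
elim: s {Is} => [|r s IH] H.
  by rewrite big_nil; exists 1; [exact: inO1|rewrite mulr1 subrr].
have [w Ow h] := IH (fun r' h => H r' (mem_behead (s := r :: s) h)).
have [w' Ow' h'] := H r (mem_head _ _).
exists (w * w'); first exact: inOM.
rewrite big_cons; set pi := \prod_(_ <- _) _ in h *.
have -> : 1 - (y - iota r) * pi * (w * w') =
   (1 - (y - iota r) * w') + (1 - pi * w) * ((y - iota r) * w') by ring.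
by apply: (ID) => //; apply: IM => //; exact: inOM.
Qed.

(* A proper ideal stays proper after adding x_i - r for a suitable root r of the
   equation satisfied by x_i; iterating over i yields a point. *)
Lemma ideal_zero I : ideal I -> ~ I 1 ->
  (exists2 q : {poly F}, q != 0 & I (map_poly iota q).[x 0]) ->
  exists v J, [/\ on_tower v, ideal J, ~ J 1, forall y, I y -> J y &
    forall i, (i <= k)%N -> J (x i - iota (v i))].
Proof.
move=> hI I1 [q q0 Iq].
suff H n : (n <= k)%N -> exists v J, [/\ forall i, (i < n)%N -> v i.+1 ^+ a i = (f i).[v i],
    ideal J, ~ J 1, forall y, I y -> J y & forall i, (i <= n)%N -> J (x i - iota (v i))].
  exact: (H k).
elim: n => [_|n IH nk].
  have [s es] := poly_splits q.
  have [||r _ hr] := @ideal_split I (x 0) s hI _ I1.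
  - exact: inOx.
  - have [_ _ _ IM] := hI; have l0 : iota (lead_coef q) != 0 by rewrite fmorph_eq0 lead_coef_eq0.
    have eq : (map_poly iota q).[x 0] = iota (lead_coef q) * \prod_(r <- s) (x 0 - iota r).
      by rewrite {1}es linearZ /= hornerZ horner_prodXsubC.
    rewrite -[X in I X](mulKf l0) -eq mulrC.
    by apply: IM => //; rewrite -fmorphV; exact: inOC.
  have Ox : inO (x 0 - iota r) by apply: inOD; [exact: inOx|apply/inON/inOC].
  exists (fun=> r), (adj I (x 0 - iota r)); split=> //.
  - exact: adj_ideal.
  - by move=> y; exact: adj_sub.
  by move=> i; rewrite leqn0 => /eqP->; exact: adj_mem.
have [v [J [tv hJ J1 IJ hv]]] := IH (ltnW nk); have [JO J0 JD JM] := hJ.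
set u := (f n).[v n]; have [s es] := poly_splits ('X^(a n) - u%:P).
have := monicXnsubC u (a_gt0 nk); rewrite monicE => /eqP lc.
rewrite lc scale1r in es.
have [||r rs hr] := @ideal_split J (x n.+1) s hJ _ J1.
- exact: inOx.
- rewrite -horner_prodXsubC -es rmorphB /= map_polyXn map_polyC !hornerE tower //.
  have [q' _ ->] := poly_taylor1 (f n) (v n).
  by apply: JM; [exact: hv|apply/inO_horner/inOx/ltnW].
have Ox : inO (x n.+1 - iota r) by apply: inOD; [exact: inOx|apply/inON/inOC].
exists (fun i => if i == n.+1 then r else v i), (adj J (x n.+1 - iota r)); split=> //.
- move=> i; rewrite ltnS leq_eqVlt => /orP[/eqP->|lin].
    rewrite eqxx ltn_eqF //; apply/eqP; rewrite -subr_eq0 -/u.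
    have : root ('X^(a n) - u%:P) r by rewrite es root_prod_XsubC.
    by rewrite /root !hornerE.
  by rewrite !ltn_eqF ?tv // ltnS ltnW.
- exact: adj_ideal.
- by move=> y /IJ; exact: adj_sub.
move=> i; rewrite leq_eqVlt => /orP[/eqP->|lin]; first by rewrite eqxx; exact: adj_mem.
by rewrite ltn_eqF //; apply/adj_sub/hv.
Qed.

(** I consists of the denominators of z. If it were proper, it would have a zero v; regularity of z
    at the point over v gives a denominator r with r(v) nonzero, and r, being in I and congruent to
    r(v) modulo J, would make J the unit ideal. *)
Lemma regular_inO z : (forall P : curve_point iota, vge P 0 (x 0) -> vge P 0 z) -> inO z.
Proof.
move=> hz; pose I y := inO y /\ inO (y * z).
have hI : ideal I.
  split=> [y []//||y y' [h1 h2] [h3 h4]|y y' [h1 h2] h3]; rewrite /I ?mul0r ?mulrDl.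
  - by split; exact: inO0.
  - by split; exact: inOD.
  by rewrite mulrAC; split; exact: inOM.
apply: contrapT => nz; have I1 : ~ I 1 by rewrite /I mul1r => -[].
have [|v [J [tv hJ J1 IJ hv]]] := ideal_zero hI I1.
  have [y [w [Oy Ow w0 e]]] := inO_frac z; have [q [s [q0 Os e']]] := divides_poly_x0 Ow w0.
  exists q => //; rewrite -e' /I; split; first exact: inOM.
  by rewrite e mulrC mulrA divfK //; exact: inOM.
have [JO J0 JD JM] := hJ.
have [j [jk sm1 sm2]] := smooth tv.
have [Pv [P0 hP]] := ordv_point tv jk sm1 sm2.
have [p [r [r0 e]]] := hP _ (hz _ P0).
have Jr : J (ev r).
  apply: IJ; split; first by exists r.
  by rewrite e mulrC divfK; [exists p|exact: (evp_neq0 tv)].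
have Jc : J (ev r - iota (evp v r)).
  apply: (@ev_congr inO J v) => //; try exact: inOD; try exact: inOM; try exact: inOC.
  exact: inOx.
apply: J1; have -> : 1 = (ev r - (ev r - iota (evp v r))) * iota (evp v r)^-1.
  by rewrite opprB addrC subrK -rmorphM divff // rmorph1.
apply: (JM); last exact: inOC.
apply: (JD) => //; rewrite -mulN1r mulrC; apply: JM => //.
exact/inON/inO1.
Qed.

(** * Logarithmic derivatives and the order of dx_0 at infinity *)

Section Infinity.
Variable P : curve_point iota.
Hypothesis hP : at_inf P.

Definition dlog_x0 := tangent 0 / x 0.
Let dlog_x0_neq0 : dlog_x0 != 0. Proof. by rewrite mulf_neq0 ?tangent0_neq0 // invr_eq0 x_neq0. Qed.
Let rho z : F := (P z)%:~R / (g 0)%:R.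
Let L z := D z / (dlog_x0 * z).
(* Modulo the maximal ideal at infinity, D z / z relative to D (x 0) / x 0 = dlog_x0
   is ord z / ord (x 0). *)
Let Q z := vge P 1 (L z + iota (rho z)).

Let g0K : (g 0)%:R != 0 :> F. Proof. by rewrite pnatr_eq0 -lt0n g_gt0. Qed.

Let QM y z : y != 0 -> z != 0 -> Q y -> Q z -> Q (y * z).
Proof.
move=> y0 z0 hy hz; rewrite /Q /L /rho; have [_ DM _] := hD; rewrite DM ord_mul //.
have -> : (D y * z + y * D z) / (dlog_x0 * (y * z)) + iota ((P y + P z)%:~R / (g 0)%:R)
   = (L y + iota (rho y)) + (L z + iota (rho z)).
  have -> : iota ((P y + P z)%:~R / (g 0)%:R) = iota (rho y) + iota (rho z).
    by rewrite /rho intrD mulrDl rmorphD.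
  by rewrite /L; field; rewrite y0 z0 dlog_x0_neq0.
exact: vgeD.
Qed.

Let QV y : y != 0 -> Q y -> Q y^-1.
Proof.
move=> y0 hy; rewrite /Q /L /rho (derV hD) // valV //.
have -> : - D y / y ^+ 2 / (dlog_x0 / y) + iota ((- P y)%:~R / (g 0)%:R) =
  - (L y + iota (rho y)).
  have -> : iota ((- P y)%:~R / (g 0)%:R) = - iota (rho y).
    by rewrite /rho mulrNz mulNr rmorphN.
  by rewrite /L; field; rewrite y0 dlog_x0_neq0.
exact: vgeN.
Qed.

Let QC c : c != 0 -> Q (iota c).
Proof.
move=> c0; rewrite /Q /L /rho ord_const //; have [_ _ ->] := hD.
by rewrite !mul0r rmorph0 addr0; left.
Qed.

Let QX y n : y != 0 -> Q y -> Q (y ^+ n).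
Proof.
move=> y0 hy; elim: n => [|n IH].
  by rewrite expr0 -(rmorph1 iota); apply: QC; exact: oner_neq0.
by rewrite exprS; apply: QM; rewrite ?expf_neq0.
Qed.

(** L(y + z) is the average of L y and L z with weights y / (y + z) and z / (y + z). The second
    weight has positive order, so its factor need only be regular, which allows the residue of y in
    place of that of z. *)
Let Qsum y z : y != 0 -> z != 0 -> P y < P z -> Q y -> Q z -> Q (y + z).
Proof.
move=> y0 z0 lt hy hz; have [|yz0 vyz] := @val_dom _ _ _ P y z y0.
  by right; lia.
rewrite /Q; have [DD _ _] := hD.
have -> : L (y + z) + iota (rho (y + z)) =
   (L y + iota (rho y)) * (y / (y + z)) + (L z + iota (rho y)) * (z / (y + z)).
  have -> : rho (y + z) = rho y by rewrite /rho vyz.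
  by rewrite /L DD; field; rewrite yz0 y0 z0 dlog_x0_neq0.
apply: vgeD.
  apply: vgeMr => //; right.
  by rewrite ord_mul ?invr_eq0 // valV // vyz subrr.
apply: vgeMl.
  have -> : L z + iota (rho y) = (L z + iota (rho z)) + iota (rho y - rho z).
    by rewrite rmorphB /=; ring.
  by apply: vgeD; [exact: vgeW hz|exact: vge_const].
by right; rewrite ord_mul ?invr_eq0 // valV // vyz; lia.
Qed.

Let Qhorner (p : {poly F}) z : z != 0 -> P z < 0 -> Q z -> p != 0 -> Q (map_poly iota p).[z].
Proof.
move=> z0 zn hz; elim/poly_ind: p => [|p c IH]; first by rewrite eqxx.
rewrite rmorphD /= rmorphM /= map_polyX map_polyC /= !hornerE.
have [->|p0] := eqVneq p 0.
  rewrite mul0r add0r rmorph0 horner0 mul0r add0r polyC_eq0; exact: QC.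
move=> _; have [h1 h2] := val_horner_pole z0 zn p0.
have h3 : Q ((map_poly iota p).[z] * z) by apply: QM => //; exact: IH.
have [->|c0] := eqVneq c 0; first by rewrite rmorph0 addr0.
apply: Qsum => //; rewrite ?mulf_neq0 ?fmorph_eq0 //; last exact: QC.
rewrite ord_const // ord_mul // h2; nia.
Qed.

Let Qx i : (i <= k)%N -> Q (x i).
Proof.
elim: i => [_|i IH ik].
  rewrite /Q /L /rho D_x // inf_val // mulrNz -pmulrn mulNr divff // rmorphN rmorph1.
  by rewrite /dlog_x0 divfK ?x_neq0 // divff ?tangent0_neq0 // subrr; left.
have [x0 xn _] := inf_coord hP (ltnW ik); have y0 := x_neq0 ik.
have := Qhorner x0 xn (IH (ltnW ik)) (f_neq0 ik); rewrite -tower // /Q.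
have an := a_gt0 ik; have aK := natK_neq0 an.
have -> : L (x i.+1 ^+ a i) + iota (rho (x i.+1 ^+ a i)) =
  iota (a i)%:R * (L (x i.+1) + iota (rho (x i.+1))).
  rewrite rmorph_nat mulrDr; congr (_ + _).
    rewrite /L (derXn hD) -{3}(prednK an) exprS.
    by field; rewrite y0 dlog_x0_neq0 expf_neq0.
  by rewrite -(rmorph_nat iota) -rmorphM /rho valX // intrM mulrA.
move=> h; have aF : (a i)%:R != 0 :> F by rewrite pnatr_eq0 -lt0n.
have aI : iota (a i)%:R != 0 by rewrite fmorph_eq0.
rewrite -[X in vge _ _ X](mulKf aI); apply: vgeMl h.
by rewrite -fmorphV; exact: vge_const.
Qed.

Let Qmon m : Q (mmap1 xv m).
Proof.
suff [] : mmap1 xv m != 0 /\ Q (mmap1 xv m) by [].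
rewrite /mmap1; elim/big_ind: _ => [|y z [y0 hy] [z0 hz]|i _].
- by rewrite oner_neq0 -(rmorph1 iota); split=> //; apply: QC; exact: oner_neq0.
- by rewrite mulf_neq0 //; split=> //; exact: QM.
have ik : (i <= k)%N := ltn_ord i.
by rewrite expf_neq0 ?x_neq0 //; split=> //; apply: QX; [exact: x_neq0|exact: Qx].
Qed.

Let Qev c : supported c -> c != 0 -> Q (ev (normal_poly c)).
Proof.
move=> sc c0.
have vm s : in_sg a b k s -> P (mmap1 xv (normal_mon s)) = - s%:Z.
  move=> ss; rewrite (@val_mmap1 P 1) ?mul1n //; first by have [_ ->] := normal_monP ss.
  by move=> i ik; rewrite mul1n inf_val.
(* Terms are added by increasing pole order; the bound says that the partial sum has pole order
   below n, so [Qsum] applies to the next term. *)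
have H n : let y := \sum_(s < n) iota c`_s * mmap1 xv (normal_mon s) in
    y = 0 \/ Q y /\ - n%:Z < P y.
  elim: n => [|n IH] /=; first by left; rewrite big_ord0.
  rewrite big_ord_recr /=; set y := \sum_(_ < _) _ in IH *.
  have [->|cn] := eqVneq c`_n 0.
    rewrite rmorph0 mul0r addr0; case: IH => [->|[h1 h2]]; [by left|right; split=> //; lia].
  have T0 : iota c`_n * mmap1 xv (normal_mon n) != 0.
    by rewrite mulf_neq0 ?fmorph_eq0 // (mmap1_neq0 _ hP).
  have PT : P (iota c`_n * mmap1 xv (normal_mon n)) = - n%:Z.
    by rewrite ord_mul ?fmorph_eq0 ?(mmap1_neq0 _ hP) // ord_const // add0r vm // sc.
  have QT : Q (iota c`_n * mmap1 xv (normal_mon n)).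
    by apply: QM; rewrite ?fmorph_eq0 ?(mmap1_neq0 _ hP) //; exact: QC.
  right; rewrite addrC; case: IH => [->|[h1 h2]]; first by rewrite addr0 PT; split=> //; lia.
  have [->|y0] := eqVneq y 0; first by rewrite addr0 PT; split=> //; lia.
  split; first by apply: Qsum => //; rewrite PT.
  have [|_ ->] := @val_dom _ _ _ P _ y T0; last by rewrite PT; lia.
  by right; rewrite PT; lia.
have := normal_poly_neq0 sc c0; rewrite /normal_poly rmorph_sum /=.
under eq_bigr => s _ do rewrite mmapZ mmapX.
by case: (H (size c)) => [->|[]//]; rewrite eqxx.
Qed.

Let Qall z : z != 0 -> Q z.
Proof.
have Qp p : ev p != 0 -> Q (ev p).
  have [c sc [-> _]] := ev_normal_poly p => h; apply: Qev => //.
  by apply: contraNneq h => ->; rewrite /normal_poly size_poly0 big_ord0 rmorph0.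
move=> z0; have [p [r [r0 e]]] := fracK z.
have p0 : ev p != 0 by apply: contraNneq z0 => p0; rewrite e p0 mul0r.
by rewrite e; apply: QM; rewrite ?invr_eq0 //; [exact: Qp|apply: QV => //; exact: Qp].
Qed.

Lemma val_tangent0 : P (tangent 0) = - (wmax a b k)%:Z.
Proof.
rewrite /tangent big_ord0 mul1r big_mkord val_prod => [|[i ik] _] /=; last first.
  by rewrite mulf_neq0 ?expf_neq0 ?x_neq0 ?natK_neq0 ?a_gt0.
rewrite wmaxE (big_morph _ PoszD (erefl 0%:Z)) -sumrN; apply: eq_bigr => -[i ik] _ /=.
rewrite ord_mul ?natK_neq0 ?a_gt0 ?expf_neq0 ?x_neq0 // -(rmorph_nat iota).
rewrite ord_const ?pnatr_eq0 -?lt0n ?a_gt0 // add0r valX ?x_neq0 // inf_val //.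
by rewrite subn1 PoszM mulrN.
Qed.

(** [L s] has residue - 1 / g_0, nonzero in characteristic 0, so it is a unit and D s has the order
    of [dlog_x0 * s]. *)
Lemma val_D_inf s : s != 0 -> P s = 1 -> D s != 0 /\ P (D s) = P (tangent 0) + (g 0)%:Z + 1.
Proof.
move=> s0 s1; have := Qall s0; rewrite /Q /rho s1; set c : F := _ / _ => h.
have c0 : iota (- c) != 0 by rewrite fmorph_eq0 oppr_eq0 mulf_neq0 ?invr_eq0 ?oner_neq0.
have [|h1 h2] := @val_dom _ _ _ P (iota (- c)) (L s + iota c) c0.
  by rewrite ord_const ?add0r // -(fmorph_eq0 iota).
move: h1 h2; rewrite rmorphN addrC addrK -rmorphN ord_const -?(fmorph_eq0 iota) //.
move=> h1 h2; have e : D s = L s * (dlog_x0 * s) by rewrite /L divfK // mulf_neq0.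
have ls0 := mulf_neq0 dlog_x0_neq0 s0; split; first by rewrite e (mulf_neq0 h1 ls0).
rewrite e (ord_mul P h1 ls0) h2 (ord_mul P dlog_x0_neq0 s0) s1 add0r /dlog_x0.
by rewrite ord_mul ?tangent0_neq0 ?invr_eq0 ?x_neq0 // valV ?x_neq0 // inf_val // opprK.
Qed.

Lemma ord_d_inf : ord_d (x 0) P = - (g 0)%:Z - 1.
Proof.
have key s E : s != 0 -> P s = 1 -> is_derivation iota E -> E s = 1 ->
    P (E (x 0)) = - (g 0)%:Z - 1.
  move=> s0 s1 hE Es; have [h1 h2] := val_D_inf s0 s1.
  have := der_prop s hE; rewrite Es mul1r => e.
  have E0 : E (x 0) != 0 by apply: contraNneq tangent0_neq0 => h; rewrite e h mul0r.
  by have := congr1 P e; rewrite ord_mul // h2; lia.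
rewrite /ord_d; case: xgetP => [n _ [s [E [s0 s1 hE Es <-]]]|h]; first exact: key Es.
have [s [s0 s1]] := ord_unif P; have [h1 h2] := val_D_inf s0 s1.
have hE : is_derivation iota (fun z => D z / D s).
  by have [DD DM DC] := hD; split=> [y z|y z|c]; rewrite ?DD ?DM ?DC; field.
case: (h (P (D (x 0) / D s))); exists s, (fun z => D z / D s); split=> //.
by rewrite divff.
Qed.

End Infinity.

(** * Holomorphic q-differentials *)

(** The order at infinity of (dx_0 / [tangent 0])^q, which has order 0 at every affine point; hence
    the degree q (2 G - 2), see [qdegreeE]. *)
Definition qdegree (q : nat) : int := q%:Z * ((wmax a b k)%:Z - (g 0)%:Z - 1).

Lemma qdiff_ord_inf (P : curve_point iota) q h : at_inf P -> h != 0 ->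
  qdiff_ord (x 0) q P h = P (h * tangent 0 ^+ q) + qdegree q.
Proof.
move=> hP h0; rewrite /qdiff_ord ord_d_inf // ord_mul ?expf_neq0 ?tangent0_neq0 //.
by rewrite valX ?tangent0_neq0 // val_tangent0 // /qdegree; ring.
Qed.

Lemma qdiff_ord_affine (P : curve_point iota) q h : vge P 0 (x 0) -> h != 0 ->
  qdiff_ord (x 0) q P h = P (h * tangent 0 ^+ q).
Proof.
move=> hP h0; rewrite /qdiff_ord affine_ord_d // ord_mul ?expf_neq0 ?tangent0_neq0 //.
by rewrite valX ?tangent0_neq0.
Qed.

Lemma holomorphicP q h : holomorphic iota (x 0) q h <->
  exists c, [/\ supported c, h * tangent 0 ^+ q = ev (normal_poly c) &
    c = 0 \/ (size c).-1%:Z <= qdegree q].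
Proof.
split=> [hh|[c [sc e hc]] P].
  have [h0|h0] := eqVneq h 0.
    exists 0; split; [by move=> s; rewrite coef0 eqxx| |by left].
    by rewrite h0 mul0r /normal_poly size_poly0 big_ord0 rmorph0.
  have [p ep] : inO (h * tangent 0 ^+ q).
    apply: regular_inO => P hP; right; case: (hh P) => [/eqP|]; first by rewrite (negPf h0).
    by rewrite qdiff_ord_affine.
  have [c sc [ec _]] := ev_normal_poly p; exists c; rewrite ep ec; split=> //; right.
  have c0 : c != 0.
    apply: contraNneq h0 => c0; move: ep; rewrite ec c0 /normal_poly size_poly0 big_ord0 rmorph0.
    by move/eqP; rewrite mulf_eq0 (negPf (expf_neq0 _ tangent0_neq0)) orbF.
  case: (hh Pinf) => [/eqP|]; first by rewrite (negPf h0).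
  by rewrite qdiff_ord_inf // ep ec val_inf //; lia.
have [h0|h0] := eqVneq h 0; [by left|right].
have [hP|hP] := pselect (vge P 0 (x 0)).
  have hm : h * tangent 0 ^+ q != 0 by rewrite mulf_neq0 ?expf_neq0 ?tangent0_neq0.
  rewrite qdiff_ord_affine //; have := @vge_inO P (h * tangent 0 ^+ q) hP.
  by rewrite vgeE //; apply; rewrite e; eexists.
have iP : at_inf P by exists 0.
have c0 : c != 0.
  apply: contraNneq h0 => c0; move: e; rewrite c0 /normal_poly size_poly0 big_ord0 rmorph0.
  by move/eqP; rewrite mulf_eq0 (negPf (expf_neq0 _ tangent0_neq0)) orbF.
case: hc => [/eqP|hc]; first by rewrite (negPf c0).
by rewrite qdiff_ord_inf // e val_inf //; lia.
Qed.

Lemma normal_poly_mon s : normal_poly 'X^s = 'X_[normal_mon s].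
Proof.
rewrite /normal_poly size_polyXn big_ord_recr /= coefXn eqxx scale1r big1 ?add0r // => i _.
by rewrite coefXn ltn_eqF // scale0r.
Qed.

Lemma normal_poly0 : normal_poly 0 = 0. Proof. by rewrite /normal_poly size_poly0 big_ord0. Qed.

Lemma normal_poly_sum (I : Type) (r : seq I) (G : I -> {poly F}) :
  normal_poly (\sum_(i <- r) G i) = \sum_(i <- r) normal_poly (G i).
Proof. exact: (big_morph normal_poly normal_polyD normal_poly0). Qed.

Lemma supported_mon s : in_sg a b k s -> supported 'X^s.
Proof.
by move=> hs t; rewrite coefXn; have [->|_] := eqVneq t s => //; rewrite eqxx.
Qed.

Lemma holo_free q d (psi : 'I_d -> K) : is_holo_basis iota (x 0) q psi ->
  forall c : 'rV[F]_d, \sum_(i < d) iota (c 0 i) * psi i = 0 -> c = 0.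
Proof.
move=> [_ hb] c hc; have h0 : holomorphic iota (x 0) q 0 by move=> P; left.
have [u [_ hu]] := hb 0 h0; rewrite -(hu c) //; apply: hu.
by rewrite big1 // => i _; rewrite mxE rmorph0 mul0r.
Qed.

Lemma holo_neq0 q d (psi : 'I_d -> K) i : is_holo_basis iota (x 0) q psi -> psi i != 0.
Proof.
move=> hb; apply/eqP => pi0; have := holo_free hb (c := delta_mx 0 i).
rewrite (bigD1 i) //= pi0 mulr0 add0r big1 => [/(_ erefl)|j ji]; last first.
  by rewrite mxE (negPf ji) andbF rmorph0 mul0r.
move/matrixP => /(_ 0 i); rewrite !mxE !eqxx => /eqP.
by rewrite oner_eq0.
Qed.

Local Notation G := (size (gaps a b k)).

Lemma qdegreeE q : qdegree q = q%:Z * (G.*2%:Z - 2).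
Proof. by rewrite twice_size_gaps // /qdegree; ring. Qed.

(** If G were at most 1, [qdegree 1] would be at most 0, leaving only constants as coefficients, so
    any two holomorphic differentials would be proportional. *)
Lemma genus_gt1 n : is_genus iota (x 0) n -> (2 <= n)%N -> (2 <= G)%N.
Proof.
move=> [psi hb] n2; rewrite leqNgt; apply/negP => G1.
have hc i : exists c : F, psi i * tangent 0 = iota c * ev 'X_[normal_mon 0].
  have [h _] := hb; have /holomorphicP[c [sc e hs]] := h i.
  exists c`_0; rewrite expr1 in e; rewrite e.
  have /size1_polyC ec : (size c <= 1)%N.
    case: hs => [->|]; first by rewrite size_poly0.
    by rewrite qdegreeE; move: G1; lia.
  by rewrite {1}ec -alg_polyC -(expr0 'X) normal_polyZ normal_poly_mon mmapZ.
pose i0 := Ordinal (ltnW n2); pose i1 := Ordinal n2.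
have [c0 h0] := hc i0; have [c1 h1] := hc i1.
have n01 : i1 != i0 by [].
pose u : 'rV[F]_n := \row_i (if i == i0 then c1 else if i == i1 then - c0 else 0).
have hu : u = 0.
  apply: (holo_free hb); rewrite (bigD1 i0) //= (bigD1 i1) //= big1 => [|i /andP[ne0 ne1]].
    rewrite !mxE eqxx (negPf n01) eqxx addr0; apply: (mulIf tangent0_neq0).
    by rewrite mul0r mulrDl -!mulrA h0 h1 rmorphN; ring.
  by rewrite mxE (negPf ne0) (negPf ne1) rmorph0 mul0r.
have := congr1 (fun w : 'rV[F]_n => w 0 i1) hu; rewrite !mxE (negPf n01) eqxx => /eqP.
rewrite oppr_eq0 => /eqP c00; have := holo_neq0 i0 hb.
by rewrite -(mulIr_eq0 _ (mulIf tangent0_neq0)) h0 c00 rmorph0 mul0r eqxx.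
Qed.

(** * Adapted bases and the weight at infinity *)

Section Weight.
Variables (q N : nat).
Hypothesis hN : qdegree q = N%:Z.

Let ss := [seq s <- seq.iota 0 N.+1 | in_sg a b k s].

Lemma mem_nongaps s : (s \in ss) = in_sg a b k s && (s <= N)%N.
Proof. by rewrite mem_filter mem_iota /= add0n ltnS. Qed.

Definition qmon s := ev 'X_[normal_mon s] / tangent 0 ^+ q.

Lemma qmonK s : qmon s * tangent 0 ^+ q = ev (normal_poly 'X^s).
Proof. by rewrite /qmon divfK ?expf_neq0 ?tangent0_neq0 // normal_poly_mon. Qed.

Lemma qmon_neq0 s : qmon s != 0.
Proof.
by rewrite mulf_neq0 ?invr_eq0 ?expf_neq0 ?tangent0_neq0 // mmapX (mmap1_neq0 _ Pinf_inf).
Qed.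

Lemma qmon_holo s : s \in ss -> holomorphic iota (x 0) q (qmon s).
Proof.
rewrite mem_nongaps => /andP[hs sN]; apply/holomorphicP; exists 'X^s.
split; [exact: supported_mon|exact: qmonK|right].
by rewrite size_polyXn hN.
Qed.

Lemma qmon_ord s : s \in ss -> qdiff_ord (x 0) q Pinf (qmon s) = N%:Z - s%:Z.
Proof.
rewrite mem_nongaps => /andP[hs sN]; rewrite qdiff_ord_inf ?qmon_neq0 // qmonK.
rewrite val_inf ?size_polyXn ?hN; first by rewrite addrC.
- exact: Pinf_inf.
- exact: supported_mon.
by rewrite monic_neq0 ?monicXn.
Qed.

Lemma holo_ord h : h != 0 -> holomorphic iota (x 0) q h ->
  exists2 s, s \in ss & qdiff_ord (x 0) q Pinf h = N%:Z - s%:Z.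
Proof.
move=> h0 /holomorphicP[c [sc e hc]].
have c0 : c != 0.
  apply: contraNneq h0 => c0; move: e; rewrite c0 normal_poly0 rmorph0.
  by move/eqP; rewrite mulf_eq0 (negPf (expf_neq0 _ tangent0_neq0)) orbF.
exists (size c).-1.
  rewrite mem_nongaps sc; last by rewrite -/(lead_coef c) lead_coef_eq0.
  by case: hc => [/eqP|]; rewrite ?(negPf c0) // hN.
by rewrite qdiff_ord_inf // e val_inf // hN addrC.
Qed.

(** Orders strictly increase along the basis, so the first basis element with a nonzero coefficient
    dominates. *)
Lemma adapted_ord d (psi : 'I_d -> K) h : adapted_basis (x 0) q Pinf psi ->
  h != 0 -> holomorphic iota (x 0) q h ->
  exists i, qdiff_ord (x 0) q Pinf h = qdiff_ord (x 0) q Pinf (psi i).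
Proof.
move=> [hb lt] h0 hh; have [_ hs] := hb; have [c [e _]] := hs h hh.
have [i ci] : exists i, c 0 i != 0.
  apply: contrapT => H; case/eqP: h0; rewrite e big1 // => i _.
  have [->|ne] := eqVneq (c 0 i) 0; first by rewrite rmorph0 mul0r.
  by case: H; exists i.
case: (@arg_minnP _ i (fun i => c 0 i != 0) (fun i => i : nat) ci) => i0 c0 hmin.
exists i0; rewrite /qdiff_ord; congr (_ + _).
have T0 : iota (c 0 i0) * psi i0 != 0 by rewrite mulf_neq0 ?fmorph_eq0 ?(holo_neq0 _ hb).
have PT : Pinf (iota (c 0 i0) * psi i0) = Pinf (psi i0).
  by rewrite ord_mul ?fmorph_eq0 ?(holo_neq0 _ hb) // ord_const // add0r.
rewrite e (bigD1 i0) //=.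
have [|_ ->] := @val_dom _ _ _ Pinf (iota (c 0 i0) * psi i0)
  (\sum_(i < d | i != i0) iota (c 0 i) * psi i) T0; last by [].
apply: vge_sum => l li; have [->|cl] := eqVneq (c 0 l) 0.
  by rewrite rmorph0 mul0r; left.
apply: vgeMl; first exact: vge_const.
have il : (i0 < l)%N.
  rewrite ltn_neqAle hmin // andbT; apply: contraNneq li => e1.
  exact/eqP/val_inj.
by right; rewrite PT; have := lt _ _ il; rewrite /qdiff_ord; lia.
Qed.

(** Both lists are duplicate-free and enumerate the orders at infinity of the nonzero holomorphic
    q-differentials, so they are permutations of each other; the dimension comes as a
    consequence. *)
Lemma adapted_weight d (psi : 'I_d -> K) : adapted_basis (x 0) q Pinf psi ->
  \sum_(i < d) qdiff_ord (x 0) q Pinf (psi i) - \sum_(j < d) (j : nat)%:Z =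
  \sum_(s <- ss) (N%:Z - s%:Z) - \sum_(0 <= j < size ss) j%:Z.
Proof.
move=> ad; have [hb lt] := ad.
pose o i := qdiff_ord (x 0) q Pinf (psi i).
have pe : perm_eq [seq o i | i <- enum 'I_d] [seq N%:Z - s%:Z | s <- ss].
  apply: uniq_perm.
  - rewrite map_inj_uniq ?enum_uniq // => i l e; apply/val_inj.
    case: (ltngtP i l) => // h.
      by have : o i < o l := lt _ _ h; rewrite e ltxx.
    by have : o l < o i := lt _ _ h; rewrite e ltxx.
  - rewrite map_inj_uniq ?filter_uniq ?iota_uniq // => s s'; lia.
  move=> z; apply/mapP/mapP => [[i _ ->]|[s hs ->]].
    have [hh _] := hb; have [s hs e] := holo_ord (holo_neq0 i hb) (hh i).
    by exists s.
  have [i e] := adapted_ord ad (qmon_neq0 s) (qmon_holo hs).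
  by exists i; rewrite ?mem_enum // /o -e qmon_ord.
have sd : d = size ss.
  by have := perm_size pe; rewrite size_map size_enum_ord size_map.
congr (_ - _); last by rewrite big_mkord sd.
transitivity (\sum_(z <- [seq o i | i <- enum 'I_d]) z); first by rewrite big_map big_enum.
by rewrite (perm_big _ pe) big_map.
Qed.

Lemma adapted_exists : exists d (psi : 'I_d -> K), adapted_basis (x 0) q Pinf psi.
Proof.
(* The order of [qmon s] is N - s, so decreasing s gives increasing orders. *)
pose sq := rev ss; pose psi (i : 'I_(size sq)) := qmon (nth 0%N sq i).
have sq_mem (i : 'I_(size sq)) : nth 0%N sq i \in ss by rewrite -mem_rev mem_nth.
have sq_uniq : uniq sq by rewrite rev_uniq filter_uniq ?iota_uniq.
have psiE (u : 'rV[F]_(size sq)) : (\sum_i iota (u 0 i) * psi i) * tangent 0 ^+ q =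
    ev (normal_poly (\sum_i u 0 i *: 'X^(nth 0%N sq i))).
  rewrite mulr_suml normal_poly_sum rmorph_sum; apply: eq_bigr => i _ /=.
  by rewrite normal_polyZ mmapZ -qmonK -mulrA.
have supp (u : 'rV[F]_(size sq)) : supported (\sum_i u 0 i *: 'X^(nth 0%N sq i)).
  elim/big_ind: _ => [|c c' sc sc'|i _].
  - by move=> s; rewrite coef0 eqxx.
  - move=> s; rewrite coefD; have [->|h _] := eqVneq c`_s 0; last exact: sc.
    by rewrite add0r; exact: sc'.
  move=> s; rewrite coefZ mulf_eq0 negb_or => /andP[_]; apply: supported_mon.
  by have := sq_mem i; rewrite mem_nongaps => /andP[].
have coefu (u : 'rV[F]_(size sq)) (l : 'I_(size sq)) :
    (\sum_i u 0 i *: 'X^(nth 0%N sq i))`_(nth 0%N sq l) = u 0 l.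
  rewrite coef_sum (bigD1 l) //= coefZ coefXn eqxx mulr1 big1 ?addr0 // => i il.
  by rewrite coefZ coefXn nth_uniq // eq_sym val_eqE (negPf il) mulr0.
have mq0 : tangent 0 ^+ q != 0 by rewrite expf_neq0 ?tangent0_neq0.
exists (size sq), psi; split; [split|].
- by move=> i; apply: qmon_holo.
- move=> h /holomorphicP[c [sc e hc]].
  have szc : (size c <= N.+1)%N.
    case: hc => [->|]; first by rewrite size_poly0.
    by rewrite hN lez_nat; lia.
  exists (\row_i c`_(nth 0%N sq i)); split.
    apply: (mulIf mq0); rewrite e psiE; congr (ev (normal_poly _)).
    under [RHS]eq_bigr => i _ do rewrite mxE.
    rewrite -(big_mkord xpredT (fun i => c`_(nth 0%N sq i) *: 'X^(nth 0%N sq i))).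
    rewrite -(big_nth 0%N xpredT (fun s => c`_s *: 'X^s)).
    rewrite (perm_big ss) /=; last by rewrite perm_rev.
    rewrite big_filter big_mkcond -{1}(subn0 N.+1) -/(index_iota 0 N.+1) big_mkord.
    rewrite -{1}[c]coefK poly_def (big_ord_widen _ (fun s => c`_s *: 'X^s) szc) big_mkcond.
    apply: eq_bigr => s _; have [->|ne] := eqVneq c`_s 0; first by rewrite scale0r !if_same.
    rewrite sc //; case: ltnP => // le.
    by move: ne; rewrite nth_default ?eqxx.
  move=> u eu; apply/rowP => l; rewrite mxE.
  have c0 : c - \sum_i u 0 i *: 'X^(nth 0%N sq i) = 0.
    have sd : supported (c - \sum_i u 0 i *: 'X^(nth 0%N sq i)).
      move=> s; rewrite coefB; have [->|? _] := eqVneq c`_s 0; last exact: sc.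
      by rewrite sub0r oppr_eq0; exact: supp.
    apply/eqP; apply: contraT => /(normal_poly_neq0 sd).
    by rewrite -[- _]scaleN1r normal_polyD normal_polyZ scaleN1r rmorphB /= -psiE -eu e subrr eqxx.
  have := congr1 (fun r : {poly F} => r`_(nth 0%N sq l)) c0.
  by rewrite coefB coefu coef0 => /eqP; rewrite subr_eq0 => /eqP.
move=> i l il; rewrite !qmon_ord //.
have st : sorted gtn sq by rewrite rev_sorted sorted_filter ?iota_ltn_sorted //; exact: ltn_trans.
have := sorted_ltn_nth (fun _ _ _ h1 h2 => ltn_trans h2 h1) 0%N st i l.
by rewrite !inE !ltn_ord => /(_ isT isT il) /=; lia.
Qed.

End Weight.

Lemma tower_weight q w : (2 <= G)%N ->
  (let N := (q * G.*2.-2)%N in let ss := [seq s <- seq.iota 0 N.+1 | in_sg a b k s] in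
   \sum_(s <- ss) (N%:R - s%:R) - \sum_(0 <= j < size ss) j%:R = w) ->
  is_weierstrass_weight (x 0) q Pinf w.
Proof.
move=> G2 /= <-; set N := (q * _)%N.
have hN : qdegree q = N%:Z by rewrite qdegreeE /N PoszM; congr (_ * _); lia.
split; first exact: (adapted_exists hN).
move=> d psi ad; rewrite (adapted_weight hN ad) rmorphB !rmorph_sum /=; congr (_ - _).
by apply: eq_bigr => s _; rewrite rmorphB.
Qed.

End Tower.

(** * The Jacobian of the tower *)

(** j is the first zero of [al], or k. If [be] vanished at some index from j on, and i is the least
    one, rows j, ..., i would be supported in columns j + 1, ..., i, one fewer than the rows. *)
Lemma bidiagonal_rank (F : fieldType) k (al be : nat -> F) :
  \rank (\matrix_(i < k, j < k.+1)
    ((j == i.+1 :> nat)%:R * be i - (j == i :> nat)%:R * al i)) = k ->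
  exists j, [/\ (j <= k)%N, forall i, (i < j)%N -> al i != 0 &
    forall i, (j <= i < k)%N -> be i != 0].
Proof.
set M := \matrix_(_, _) _ => rM.
pose j := find (fun i => al i == 0) (iota 0 k).
have jk : (j <= k)%N by rewrite (leq_trans (find_size _ _)) ?size_iota.
exists j; split=> // [i ij|i0 /andP[ji0 i0k]].
  by have := before_find 0%N ij; rewrite nth_iota ?add0n ?(leq_trans ij) // => ->.
apply/negP => b0.
have alj : al j = 0.
  have jk' := leq_ltn_trans ji0 i0k.
  have /(nth_find 0%N) : has (fun i => al i == 0) (iota 0 k) by rewrite has_find size_iota.
  by rewrite -/j nth_iota // add0n => /eqP.
have ex : exists i, [&& (j <= i)%N, (i < k)%N & be i == 0] by exists i0; rewrite ji0 i0k.
case: (ex_minnP ex) => i /and3P[ji ik /eqP bi] imin {i0 ji0 i0k b0 ex}.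
(* Coefficients of the relation between rows j, ..., i: in an inner column c the contributions of
   rows c - 1 and c cancel. *)
pose U l := if (j <= l <= i)%N then \prod_(j <= s < l) be s * \prod_(l.+1 <= s < i.+1) al s
  else 0.
pose u : 'rV[F]_k := \row_l U l.
have uM : u *m M = 0.
  apply/rowP => c; rewrite !mxE.
  under eq_bigr => l _ do rewrite !mxE mulrBr.
  rewrite sumrB.
  have E1 : \sum_(l < k) U l * ((c == l.+1 :> nat)%:R * be l) =
      if (0 < c)%N then U c.-1 * be c.-1 else 0.
    case: ltnP => [c0|].
      have ck : (c.-1 < k)%N by rewrite -ltnS prednK.
      rewrite (bigD1 (Ordinal ck)) //= prednK // eqxx mul1r big1 ?addr0 // => l ne.
      have -> : (c == l.+1 :> nat) = false.
        by apply/negP => /eqP e; case/eqP: ne; apply/val_inj; rewrite /= e.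
      by rewrite mul0r mulr0.
    by rewrite leqn0 => /eqP c0; rewrite big1 // => l _; rewrite c0 mul0r mulr0.
  have E2 : \sum_(l < k) U l * ((c == l :> nat)%:R * al l) = U c * al c.
    case: (ltnP c k) => [ck|kc].
      rewrite (bigD1 (Ordinal ck)) //= eqxx mul1r big1 ?addr0 // => l ne.
      have -> : (c == l :> nat) = false.
        by apply/negP => /eqP e; case/eqP: ne; apply/val_inj; rewrite /= e.
      by rewrite mul0r mulr0.
    have -> : U c = 0 by rewrite /U [(c <= i)%N]leqNgt (leq_trans ik kc) andbF.
    rewrite mul0r big1 // => l _.
    have -> : (c == l :> nat) = false by rewrite gtn_eqF // (leq_trans (ltn_ord l)).
    by rewrite mul0r mulr0.
  rewrite E1 E2; apply/eqP; rewrite subr_eq0; apply/eqP.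
  have [cj|jc|cj] := ltngtP c j.
  - have -> : U c = 0 by rewrite /U leqNgt cj.
    rewrite mul0r; case: ifP => // c0; have -> : U c.-1 = 0.
      by rewrite /U leqNgt (leq_ltn_trans (leq_pred c) cj).
    by rewrite mul0r.
  - have c0 : (0 < c)%N by apply: leq_ltn_trans jc.
    rewrite c0; case: (nat_of_ord c) jc c0 => // c' jc _ /=.
    rewrite /U (ltnW jc) -ltnS jc /=.
    have [ci|ic] := ltnP c' i.
      rewrite (ltnW ci) (@big_nat_recr _ _ _ c' j) //= (@big_ltn _ _ _ c'.+1 i.+1) //.
      by ring.
    rewrite mul0r; case: ifP => [ci'|]; last by rewrite mul0r.
    by have -> : c' = i by [apply/eqP; rewrite eqn_leq ci' ic]; rewrite bi mulr0.
  rewrite cj alj mulr0; case: ifP => // j0.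
  have -> : U j.-1 = 0 by rewrite /U leqNgt prednK // leqnn.
  by rewrite mul0r.
have /row_freeP[N MN] : row_free M by rewrite /row_free rM.
have u0 : u = 0 by rewrite -[u]mulmx1 -MN mulmxA uM mul0mx.
(* The coefficient of row i is the product of the [be s] for j <= s < i, nonzero by minimality of
   i. *)
have := congr1 (fun w : 'rV[F]_k => w 0 (Ordinal ik)) u0; rewrite !mxE /= /U ji leqnn /=.
rewrite [X in _ * X]big_geq // mulr1 => /eqP; apply/negP.
rewrite prodf_seq_neq0; apply/allP => s; rewrite mem_index_iota => /andP[js si]; apply/eqP => bs.
by have := imin s; rewrite js (ltn_trans si ik) bs eqxx /= => /(_ isT); rewrite leqNgt si.
Qed.

Section TowerEq.
Variables (F : fieldType) (k : nat) (A : k.-tuple nat) (f : 'I_k -> {poly F}).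

Lemma mmap_horner (K : fieldType) (h : {rmorphism F -> K}) n (y : 'I_n -> K) (p : {poly F}) w :
  mmap h y (map_poly (@mpolyC n F) p).['X_w] = (map_poly h p).[y w].
Proof.
rewrite -horner_map /= mmapX mmap1U -map_poly_comp; congr (_.[_]).
by apply: eq_map_poly => c /=; rewrite mmapC.
Qed.

Lemma mmap_tower_eq (K : fieldType) (h : {rmorphism F -> K}) (y : 'I_k.+1 -> K) i :
  mmap h y (tower_eq A f i) =
  y (lift ord0 i) ^+ tnth A i - (map_poly h (f i)).[y (widen_ord (leqnSn k) i)].
Proof. by rewrite /tower_eq rmorphB rmorphXn /= mmap_horner mmapX mmap1U. Qed.

Lemma meval_tower_eq (v : 'I_k.+1 -> F) i : (tower_eq A f i).@[v] =
  v (lift ord0 i) ^+ tnth A i - (f i).[v (widen_ord (leqnSn k) i)].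
Proof.
rewrite /meval mmap_tower_eq; congr (_ - _.[_]).
by rewrite (eq_map_poly (g := id)) ?map_poly_id.
Qed.

Lemma meval_mderivX n (v : 'I_n -> F) (i j : 'I_n) :
  ('X_i^`M(j)).@[v] = (j == i)%:R.
Proof.
rewrite mderivX mnm1E mevalZ eq_sym; have [->|_] := eqVneq j i; last by rewrite mul0r.
rewrite (_ : (U_(i) - U_(i))%MM = 0%MM) ?mpolyX0 ?meval1 ?mulr1 //.
by apply/mnmP => l; rewrite mnmBE mnm0E subnn.
Qed.

Lemma meval_mderivXn n (v : 'I_n -> F) (p : {mpoly F[n]}) j m :
  ((p ^+ m)^`M(j)).@[v] = m%:R * p.@[v] ^+ m.-1 * (p^`M(j)).@[v].
Proof.
elim: m => [|m IH]; first by rewrite expr0 mderivC meval0 !mul0r.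
rewrite exprS mderivM mevalD !mevalM IH rmorphXn /=; case: m {IH} => [|m] /=.
  by rewrite expr0; ring.
by rewrite -(natr1 m.+1) !exprS; ring.
Qed.

Lemma meval_mderiv_horner n (v : 'I_n -> F) (p : {poly F}) w j :
  (((map_poly (@mpolyC n F) p).['X_w])^`M(j)).@[v] = (j == w)%:R * p^`().[v w].
Proof.
elim/poly_ind: p => [|p c IH].
  by rewrite deriv0 rmorph0 !horner0 mderiv0 meval0 mulr0.
rewrite derivD derivM derivX derivC addr0 mulr1 rmorphD rmorphM /= map_polyX map_polyC /=.
rewrite !hornerE mderivD mderivM mderivC addr0 mevalD !mevalM IH meval_mderivX mevalXU.
rewrite /meval mmap_horner (eq_map_poly (g := id)) ?map_poly_id //.
by ring.
Qed.

Lemma jacobian_tower_eq (v : 'I_k.+1 -> F) i j : ((tower_eq A f i)^`M(j)).@[v] =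
  (j == i.+1 :> nat)%:R * ((tnth A i)%:R * v (lift ord0 i) ^+ (tnth A i).-1)
  - (j == i :> nat)%:R * (f i)^`().[v (widen_ord (leqnSn k) i)].
Proof.
rewrite /tower_eq mderivB mevalB meval_mderivXn meval_mderiv_horner meval_mderivX mevalXU.
have -> : (j == lift ord0 i) = (j == i.+1 :> nat) by [].
have -> : (j == widen_ord (leqnSn k) i) = (j == i :> nat) by [].
by ring.
Qed.

End TowerEq.

(** * The curve as an instance of the tower *)

Theorem theorem5p10 (R : realType) (k : nat) (A B : k.-tuple nat)
  (k_gt0 : (0 < k)%N)
  (A_gt0 : forall i : 'I_k, (0 < tnth A i)%N)
  (B_gt0 : forall i : 'I_k, (0 < tnth B i)%N)
  (coprimeAB : forall i j : 'I_k, coprime (tnth A i) (tnth B j))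
  (f : 'I_k -> {poly R[i]})
  (f_sep : forall i : 'I_k, separable_poly (f i))
  (f_deg : forall i : 'I_k, size (f i) = (tnth B i).+1)
  (nonsing : nonsingular_curve (tower_eq A f))
  (K : fieldType) (iota : {rmorphism R[i] -> K}) (x : 'I_k.+1 -> K)
  (K_funfield : is_function_field iota (zero_locus (tower_eq A f)) x)
  (g : nat) (g_genus : is_genus iota (x ord0) g) (g_ge2 : (2 <= g)%N)
  (Pinf : curve_point iota) (Pinf_infty : at_infinity x Pinf)
  (q : nat) (q_gt0 : (0 < q)%N) :
  is_weierstrass_weight (x ord0) q Pinf
    (if q == 1%N
     then (S0 (sqr_seq A) (sqr_seq B))%:R / 12%:R - (S0 A B)%:R
     else (S0 (sqr_seq A) (sqr_seq B))%:R / 12%:R).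
Proof.
(* Tuples and families over ordinals become functions on [nat], as inductions along the tower
   require; values beyond the range are defaults. *)
pose a := nth 0%N A; pose b := nth 0%N B.
pose fn i : {poly R[i]} := oapp f 0 (insub i).
pose xn i : K := x (inord i).
have aE (i : 'I_k) : tnth A i = a i by rewrite (tnth_nth 0%N).
have bE (i : 'I_k) : tnth B i = b i by rewrite (tnth_nth 0%N).
have fE (i : 'I_k) : fn i = f i by rewrite /fn valK.
have gab : admissible a b k.
  split=> [i ik|i ik|i j ik jk].
  - by have := A_gt0 (Ordinal ik); rewrite aE.
  - by have := B_gt0 (Ordinal ik); rewrite bE.
  by have := coprimeAB (Ordinal ik) (Ordinal jk); rewrite aE bE.
have lE (i : 'I_k) : lift ord0 i = inord i.+1 :> 'I_k.+1.
  by apply: val_inj; rewrite /= inordK // ltnS.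
have wE (i : 'I_k) : widen_ord (leqnSn k) i = inord i :> 'I_k.+1.
  by apply: val_inj; rewrite /= inordK // ltnS ltnW.
have [ker frac] := K_funfield.
have f_size i : (i < k)%N -> size (fn i) = (b i).+1.
  by move=> ik; have := f_deg (Ordinal ik); rewrite -fE bE.
have tower i : (i < k)%N -> xn i.+1 ^+ a i = (map_poly iota (fn i)).[xn i].
  move=> ik; pose o := Ordinal ik.
  have : mmap iota x (tower_eq A f o) = 0 by apply/ker => v; apply.
  rewrite mmap_tower_eq aE lE wE -fE => /eqP; rewrite subr_eq0 => /eqP.
  by [].
have xvE : @xv K k xn = x by apply/funext => i; rewrite /xv /xn inord_val.
have fracK z : exists p r, mmap iota (@xv K k xn) r != 0 /\
    z = mmap iota (@xv K k xn) p / mmap iota (@xv K k xn) r by rewrite xvE; exact: frac.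
have locus (v : nat -> R[i]) : on_tower k a fn v ->
    zero_locus (tower_eq A f) (fun i => v i).
  move=> tv i; rewrite meval_tower_eq aE lE wE -fE !inordK ?ltnS ?(ltnW (ltn_ord i)) //.
  by rewrite tv // subrr.
have ev_point p : mmap iota (@xv K k xn) p = 0 -> forall v, on_tower k a fn v ->
    meval (fun i : 'I_k.+1 => v (i : nat)) p = 0.
  by rewrite xvE => /ker h v tv; apply/h/locus.
have smooth v : on_tower k a fn v -> exists j, [/\ (j <= k)%N,
    forall i, (i < j)%N -> (fn i)^`().[v i] != 0 &
    forall i, (j <= i < k)%N -> (a i)%:R * v i.+1 ^+ (a i).-1 != 0].
  move=> tv; apply: (@bidiagonal_rank _ k (fun i => (fn i)^`().[v i])
    (fun i => (a i)%:R * v i.+1 ^+ (a i).-1)).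
  rewrite -[RHS](nonsing _ (locus _ tv)); congr (\rank _).
  apply/matrixP => i j; rewrite !mxE jacobian_tower_eq aE -fE lE wE.
  by rewrite !inordK ?ltnS ?(ltnW (ltn_ord i)).
have x0E : x ord0 = xn 0 by rewrite /xn; congr x; apply: val_inj; rewrite /= inordK.
have Pinf_inf : at_inf k xn Pinf.
  case: Pinf_infty => i hi; exists (i : nat); first exact: ltn_ord i.
  by rewrite /xn inord_val.
have [D [hD D_ev]] := derivation_exists gab f_size tower Pinf_inf fracK.
rewrite x0E in g_genus *.
have szA : size A = k by rewrite size_tuple.
have S0G : S0 A B = size (gaps a b k) by rewrite S0E szA.
(* The genus hypothesis, which concerns the dimension of the holomorphic differentials, is converted
   into a bound on the number of gaps. *)
have G2 : (2 <= size (gaps a b k))%N.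
  exact: (genus_gt1 gab f_size tower Pinf_inf fracK hD D_ev ev_point smooth g_genus g_ge2).
apply: (tower_weight gab f_size tower Pinf_inf fracK hD D_ev ev_point smooth G2).
have := @weight_count A B; rewrite szA -/a -/b => /(_ gab q _ q_gt0).
by rewrite S0G => /(_ _ G2 erefl).
Qed.
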